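(* Let $n \geq 0$ be an integer and let $R$ be a Gorenstein $n$-coherent ring. Then the left Gorenstein weak global dimension $\mathrm{l.w.Ggl}_{\mathcal{FP}_n\text{-}\mathrm{Inj}(R^{\mathrm{op}})}(R)$ relative to the class $\mathcal{GF}_{\mathcal{FP}_n\text{-}\mathrm{Inj}(R^{\mathrm{op}})}$ is finite and coincides with $\mathrm{fd}(\mathcal{FP}_n\text{-}\mathrm{Inj}(R^{\mathrm{op}}))$.
   Context: $R$ is an associative ring with identity; $\mathrm{Mod}(R)$ is the category of left $R$-modules and right $R$-modules are identified with left $R^{\mathrm{op}}$-modules. For a class $\mathcal{X}$ of modules, $\mathrm{fd}(\mathcal{X}) := \sup\{\mathrm{fd}(X) : X \in \mathcal{X}\}$, where $\mathrm{fd}$ is flat dimension. A left $R$-module $M$ is finitely $n$-presented if there is an exact sequence $P_n \to \cdots \to P_1 \to P_0 \to M \to 0$ with each $P_i$ finitely generated free; $\mathcal{FP}_n(R)$ is the class of these. A left $R$-module $E$ is $\mathcal{FP}_n$-injective if $\mathrm{Ext}^1_R(M,E)=0$ for all $M \in \mathcal{FP}_n(R)$; the class of these is $\mathcal{FP}_n\text{-}\mathrm{Inj}(R)$. The classes $\mathcal{FP}_n(R^{\mathrm{op}})$ and $\mathcal{FP}_n\text{-}\mathrm{Inj}(R^{\mathrm{op}})$ are the analogous classes of right $R$-modules. $R$ is left $n$-coherent if $\mathcal{FP}_n(R) \subseteq \mathcal{FP}_{n+1}(R)$; right $n$-coherent is defined analogously with $R^{\mathrm{op}}$. $R$ is Gorenstein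 $n$-coherent if it is left and right $n$-coherent and there is an integer $m \geq 0$ such that $\mathrm{fd}(M) \leq m$ and $\mathrm{fd}(N) \leq m$ for all $M \in \mathcal{FP}_n\text{-}\mathrm{Inj}(R)$ and $N \in \mathcal{FP}_n\text{-}\mathrm{Inj}(R^{\mathrm{op}})$. For a class $\mathcal{B}$ of right $R$-modules, $\mathcal{GF}_{\mathcal{B}}$ is the class of left $R$-modules $G \cong \mathrm{Ker}(F^0 \to F^1)$ for some exact complex $\cdots \to F_1 \to F_0 \to F^0 \to F^1 \to \cdots$ of flat left $R$-modules which remains exact after applying $B \otimes_R -$ for every $B \in \mathcal{B}$. $\mathrm{Gfd}_{\mathcal{B}}(M)$ is the least $k \geq 0$ for which there is an exact sequence $0 \to G_k \to \cdots \to G_0 \to M \to 0$ with all $G_i \in \mathcal{GF}_{\mathcal{B}}$ ($\infty$ if none exists), and $\mathrm{l.w.Ggl}_{\mathcal{B}}(R) := \sup\{\mathrm{Gfd}_{\mathcal{B}}(M) : M \in \mathrm{Mod}(R)\}$. *)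

(* Defs.v *)
From HB Require Import structures.
From mathcomp Require Import all_boot all_order all_algebra.
From mathcomp Require Import generic_quotient ring_quotient.
From mathcomp Require Import boolp.
From mathcomp.multinomials Require Import freeg.

Set Implicit Arguments.
Unset Strict Implicit.
Unset Printing Implicit Defensive.

Import GRing.Theory.

Local Open Scope ring_scope.
Local Open Scope quotient_scope.

(* Left R-modules are [lmodType R]; right R-modules are [lmodType R^c], where
   [R^c] is the opposite ring, so that m . r is written [(r : R^c) *: m]. The
   rings are [pzRingType]s: the zero ring is allowed. *)

(* Tensor product over R of a right module B and a left module M: the quotient
   of the free abelian group on B * M by the subgroup [tens_rel]. *)

Inductive tens_rel (R : pzRingType) (B : lmodType R^c) (M : lmodType R) :
    {freeg (B * M)%type / int} -> Prop :=
| tens_rel0 : tens_rel 0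
| tens_relB x y : tens_rel x -> tens_rel y -> tens_rel (x - y)
| tens_relDl b b' m :
    tens_rel (<< (b + b', m) >> - << (b, m) >> - << (b', m) >>)
| tens_relDr b m m' :
    tens_rel (<< (b, m + m') >> - << (b, m) >> - << (b, m') >>)
| tens_relZ (r : R) b m :
    tens_rel (<< ((r : R^c) *: b, m) >> - << (b, r *: m) >>).

Definition tens_pred (R : pzRingType) (B : lmodType R^c) (M : lmodType R) :
  {pred {freeg (B * M)%type / int}} := fun x => `[< tens_rel x >].

Lemma tens_pred_zmod_closed (R : pzRingType) (B : lmodType R^c)
  (M : lmodType R) : zmod_closed (@tens_pred R B M).
Proof.
split; first exact/asboolP/tens_rel0.
by move=> x y /asboolP hx /asboolP hy; apply/asboolP/tens_relB.
Qed.

HB.instance Definition _ (R : pzRingType) (B : lmodType R^c) (M : lmodType R) :=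
  GRing.isZmodClosed.Build _ (@tens_pred R B M) (tens_pred_zmod_closed B M).

Definition tens (R : pzRingType) (B : lmodType R^c) (M : lmodType R) :
  zmodType := Quotient.quot (@tens_pred R B M).

Section TensPi.
Variables (R : pzRingType) (B : lmodType R^c) (M : lmodType R).

Definition tens_pi (x : {freeg (B * M)%type / int}) : tens B M :=
  \pi_(Quotient.quot (@tens_pred R B M)) x.

Lemma tens_pi_zmod_morphism : zmod_morphism tens_pi.
Proof. exact: (raddfB \pi_(Quotient.quot (@tens_pred R B M))). Qed.

HB.instance Definition _ :=
  GRing.isZmodMorphism.Build _ (tens B M) tens_pi tens_pi_zmod_morphism.

Lemma tens_piP x y : tens_pi x = tens_pi y <-> tens_rel (x - y).
Proof.
split=> [/eqP|hxy]; last apply/eqP.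
  by rewrite -Quotient.idealrBE => /asboolP.
by rewrite -Quotient.idealrBE; apply/asboolP.
Qed.

Lemma tens_pi_surj x : exists y, tens_pi y = x.
Proof. by exists (repr (x : Quotient.quot (@tens_pred R B M))); apply: reprK. Qed.

Definition tensor (b : B) (m : M) : tens B M := tens_pi << (b, m) >>.

End TensPi.

Definition balanced (R : pzRingType) (B : lmodType R^c) (M : lmodType R)
    (V : zmodType) (h : B -> M -> V) : Prop :=
  [/\ forall b b' m, h (b + b') m = h b m + h b' m,
      forall b m m', h b (m + m') = h b m + h b m' &
      forall (r : R) b m, h ((r : R^c) *: b) m = h b (r *: m)].

Lemma tensor_balanced (R : pzRingType) (B : lmodType R^c) (M : lmodType R) :
  balanced (@tensor R B M).
Proof.
split=> [b b' m|b m m'|r b m]; rewrite /tensor -?raddfD; apply/tens_piP.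
- by rewrite opprD addrA; apply: tens_relDl.
- by rewrite opprD addrA; apply: tens_relDr.
- exact: tens_relZ.
Qed.

(* The additive map induced by h when h is balanced; junk otherwise. *)
Definition tens_lift (R : pzRingType) (B : lmodType R^c) (M : lmodType R)
    (V : zmodType) (h : B -> M -> V) (x : tens B M) : V :=
  fglift (fun bm => h bm.1 bm.2 : zmodule V)
    (repr (x : Quotient.quot (@tens_pred R B M))).

Section TensLift.
Variables (R : pzRingType) (B : lmodType R^c) (M : lmodType R).
Variables (V : zmodType) (h : B -> M -> V).
Hypothesis hbal : balanced h.

Let L (x : {freeg (B * M)%type / int}) : V :=
  fglift (fun bm => h bm.1 bm.2 : zmodule V) x.

Let LB x y : L (x - y) = L x - L y.
Proof. exact: (@lift_is_additive _ _ (zmodule V) _ x y). Qed.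

Let L0 : L 0 = 0.
Proof. by have := LB 0 0; rewrite !subrr. Qed.

Let LU z b m : L << z *g (b, m) >> = h b m *~ z.
Proof. exact: (@liftU _ (zmodule V)). Qed.

Lemma tens_lift_rel x : tens_rel x -> L x = 0.
Proof.
case: hbal => hDl hDr hZ.
elim=> [|{}x y _ hx _ hy|b b' m|b m m'|r b m].
- exact: L0.
- by rewrite LB hx hy subr0.
- by rewrite !LB !LU !mulr1z hDl -addrA -opprD subrr.
- by rewrite !LB !LU !mulr1z hDr -addrA -opprD subrr.
- by rewrite !LB !LU !mulr1z hZ subrr.
Qed.

Lemma tens_lift_pi x : tens_lift h (tens_pi x) = L x.
Proof.
apply/eqP; rewrite -subr_eq0 -LB; apply/eqP/tens_lift_rel/tens_piP.
exact: reprK.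
Qed.

Lemma tens_liftE b m : tens_lift h (tensor b m) = h b m.
Proof. by rewrite tens_lift_pi LU mulr1z. Qed.

Lemma tens_lift_zmod_morphism : zmod_morphism (tens_lift h).
Proof.
move=> x y; have [{}x <-] := tens_pi_surj x; have [{}y <-] := tens_pi_surj y.
by rewrite -raddfB !tens_lift_pi LB.
Qed.

Lemma tens_lift_unique (k : {additive tens B M -> V}) :
  (forall b m, k (tensor b m) = h b m) -> k =1 tens_lift h.
Proof.
move=> hk x; have [{}x <-] := tens_pi_surj x; rewrite tens_lift_pi.
have LN y : L (- y) = - L y by have := LB 0 y; rewrite sub0r L0 sub0r.
have LD y z : L (y + z) = L y + L z by rewrite -{1}[z]opprK LB LN opprK.
elim/freeg_ind_dom0: x => [|z [b m] x _ _ IHx]; first by rewrite !raddf0.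
rewrite LD !raddfD /= IHx LU; congr (_ + _).
rewrite -hk -[z in LHS]intz -freegU_mulz !raddfMz.
by [].
Qed.

End TensLift.

Definition tens_map (R : pzRingType) (A B : lmodType R^c) (M N : lmodType R)
    (f : {linear A -> B}) (g : {linear M -> N}) : tens A M -> tens B N :=
  tens_lift (fun a m => tensor (f a) (g m)).

Lemma tens_map_balanced (R : pzRingType) (A B : lmodType R^c)
    (M N : lmodType R) (f : {linear A -> B}) (g : {linear M -> N}) :
  balanced (fun a m => tensor (f a) (g m)).
Proof.
have [Dl Dr Z] := tensor_balanced B N.
by split=> *; rewrite ?linearD ?linearZ ?Dl ?Dr ?Z.
Qed.

Lemma tens_mapE (R : pzRingType) (A B : lmodType R^c) (M N : lmodType R)
    (f : {linear A -> B}) (g : {linear M -> N}) a m :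
  tens_map f g (tensor a m) = tensor (f a) (g m).
Proof. exact: (tens_liftE (tens_map_balanced f g)). Qed.

HB.instance Definition _ (R : pzRingType) (A B : lmodType R^c)
    (M N : lmodType R) (f : {linear A -> B}) (g : {linear M -> N}) :=
  GRing.isZmodMorphism.Build (tens A M) (tens B N) (tens_map f g)
    (tens_lift_zmod_morphism (tens_map_balanced f g)).

(* Values in {0, 1, 2, ..., oo}; [None] is oo. *)

Definition enat := option nat.

Definition le_enat (x y : enat) : Prop :=
  match x, y with
  | _, None => True
  | None, Some _ => False
  | Some a, Some b => (a <= b)%N
  end.

(* The least k satisfying P, and oo when there is none. *)
Definition enat_least (P : nat -> Prop) : enat :=
  match pselect (exists k, `[< P k >]) with
  | left exP => Some (ex_minn exP)
  | right _ => None
  end.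

Definition enat_sup (S : enat -> Prop) : enat :=
  enat_least (fun k => forall x, S x -> le_enat x (Some k)).

Definition exact_at (A : Type) (B C : zmodType) (f : A -> B) (g : B -> C) :
    Prop :=
  forall b, g b = 0 <-> exists a, f a = b.

(* Diagrams ... -> X_2 -> X_1 -> X_0 -> M. *)
Record augmented (R : pzRingType) (M : lmodType R) := Augmented {
  term : nat -> lmodType R;
  diff : forall i, {linear term i.+1 -> term i};
  aug : {linear term 0%N -> M} }.

(* Exactness of X_n -> ... -> X_1 -> X_0 -> M -> 0 at every spot but X_n; the
   terms beyond X_n play no role. *)
Definition exact_upto (R : pzRingType) (M : lmodType R) (n : nat)
    (X : augmented M) : Prop :=
  [/\ forall m, exists x, aug X x = m,
      (0 < n)%N -> exact_at (diff X 0) (aug X) &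
      forall i, (i.+1 < n)%N -> exact_at (diff X i.+1) (diff X i)].

Definition is_resolution (R : pzRingType) (M : lmodType R)
    (X : augmented M) : Prop :=
  forall n, exact_upto n X.

(* An exact sequence 0 -> X_k -> ... -> X_0 -> M -> 0 is encoded as a
   resolution whose terms vanish beyond k. *)
Definition has_resolution (R : pzRingType) (C : lmodType R -> Prop)
    (M : lmodType R) (k : nat) : Prop :=
  exists X : augmented M,
    [/\ is_resolution X,
        forall i, (i <= k)%N -> C (term X i) &
        forall i, (k < i)%N -> forall x : term X i, x = 0].

Definition resolution_dim (R : pzRingType) (C : lmodType R -> Prop)
    (M : lmodType R) : enat :=
  enat_least (has_resolution C M).

Definition flat (R : pzRingType) (F : lmodType R) : Prop :=
  forall (A B C : lmodType R^c) (f : {linear A -> B}) (g : {linear B -> C}),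
    exact_at f g ->
    exact_at (tens_map f (idfun : {linear F -> F}))
             (tens_map g (idfun : {linear F -> F})).

Definition fd (R : pzRingType) (M : lmodType R) : enat :=
  resolution_dim (@flat R) M.

Definition fd_class (R : pzRingType) (C : lmodType R -> Prop) : enat :=
  enat_sup (fun d => exists2 M, C M & d = fd M).

Definition projective (R : pzRingType) (P : lmodType R) : Prop :=
  forall (A B : lmodType R) (g : {linear A -> B}) (f : {linear P -> B}),
    (forall b, exists a, g a = b) ->
    exists h : {linear P -> A}, forall x, g (h x) = f x.

(* Ext^1_R(M, E) = 0: for a projective resolution P of M, the complex
   Hom(P_0, E) -> Hom(P_1, E) -> Hom(P_2, E) is exact in the middle. *)
Definition Ext1_zero (R : pzRingType) (M E : lmodType R) : Prop :=
  forall P : augmented M,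
    is_resolution P -> (forall i, projective (term P i)) ->
    forall f : {linear term P 1 -> E},
      (forall x, f (diff P 1 x) = 0) ->
      exists g : {linear term P 0 -> E}, forall x, f x = g (diff P 0 x).

Definition fg_free (R : pzRingType) (F : lmodType R) : Prop :=
  exists (k : nat) (f : {linear F -> 'rV[R]_k}), bijective f.

Definition FP (n : nat) (R : pzRingType) (M : lmodType R) : Prop :=
  exists X : augmented M,
    exact_upto n X /\ (forall i, (i <= n)%N -> fg_free (term X i)).

Definition FP_inj (n : nat) (R : pzRingType) (E : lmodType R) : Prop :=
  forall M : lmodType R, FP n M -> Ext1_zero M E.

Definition left_coherent (n : nat) (R : pzRingType) : Prop :=
  forall M : lmodType R, FP n M -> FP n.+1 M.

Definition right_coherent (n : nat) (R : pzRingType) : Prop :=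
  left_coherent n R^c.

Definition gorenstein_coherent (n : nat) (R : pzRingType) : Prop :=
  [/\ left_coherent n R, right_coherent n R &
      exists m : nat,
        (forall M : lmodType R, FP_inj n M -> le_enat (fd M) (Some m)) /\
        (forall N : lmodType R^c, FP_inj n N -> le_enat (fd N) (Some m))].

(* The complex ... -> F_1 -> F_0 -> F^0 -> F^1 -> ... is indexed by the
   integers, with F i = F^i for i >= 0 and F (- i - 1) = F_i; the map j
   identifies G with the kernel of F^0 -> F^1. *)
Definition GF (R : pzRingType) (BB : lmodType R^c -> Prop) (G : lmodType R) :
    Prop :=
  exists (F : int -> lmodType R) (d : forall i : int, {linear F i -> F (i + 1)}),
    [/\ forall i, flat (F i),
        forall i, exact_at (d i) (d (i + 1)),
        forall B, BB B -> forall i,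
          exact_at (tens_map (idfun : {linear B -> B}) (d i))
                   (tens_map (idfun : {linear B -> B}) (d (i + 1))) &
        exists j : {linear G -> F 0}, injective j /\ exact_at j (d 0)].

Definition Gfd (R : pzRingType) (BB : lmodType R^c -> Prop) (M : lmodType R) :
    enat :=
  resolution_dim (GF BB) M.

Definition lwGgl (R : pzRingType) (BB : lmodType R^c -> Prop) : enat :=
  enat_sup (fun d => exists M : lmodType R, d = Gfd BB M).

(* Main.v *)
Require Import Defs.
From HB Require Import structures.
From mathcomp Require Import all_boot all_algebra.
From mathcomp Require Import generic_quotient ring_quotient.
From mathcomp Require Import boolp classical_sets functions.
From mathcomp.finmap Require Import finmap.
From mathcomp.multinomials Require Import monalg.

Set Implicit Arguments.
Unset Strict Implicit.
Unset Printing Implicit Defensive.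

Import GRing.Theory.
Local Open Scope ring_scope.

(** Write Tor_i(B, M) for a right module B and a left module M, fd for flat
   dimension, and BB for the class of FP_n-injective right modules. The theorem
   follows from the equivalence, for every natural number k, of
   - every left module has a resolution of length k by modules of GF BB;
   - every B in BB has flat dimension at most k,
   because both sides of the announced equality are the least bound k of their
   family, and the second bound holds for some k by the Gorenstein condition.

   From left modules to BB. A module G of GF BB is a cycle of a doubly infinite
   exact complex of flat modules that stays exact under B ⊗ -. So all cycles X
   of the complex satisfy Tor_1(B, X) = 0, and as they are syzygies of each
   other, Tor_i(B, G) = 0 for all i > 0 ([GF_TorS_zero]). Along a resolution of
   length k this gives Tor_(k+1)(B, M) = 0 for all M ([TorS_zero_res]), which
   says that B has flat dimension at most k ([flat_resolution_right]).

   From BB to left modules. Suppose that fd B <= k for all B in BB. Injective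
   left modules E are FP_n-injective, so they have finite flat dimension. In
   fact fd E <= k: if Tor_(t+1)(-, E) = 0 and t > k, an embedding of a right
   module N in an injective module I, which lies in BB, embeds Tor_t(N, E) in
   Tor_t(I, E) = 0, and one descends from t + 1 to t ([flat_syz_descend]).
   Now let M be any left module and embed it in an injective module E with
   cokernel L. The horseshoe lemma produces an exact sequence
   0 -> S^k M -> S^k E -> S^k L -> 0 of k-th syzygies, whose middle term is flat
   ([horseshoe]). Hence the k-th syzygies form a class that can be continued to
   the right and, by flat covers, to the left; splicing gives a complex of flat
   modules, and it stays exact under B ⊗ - since Tor_1(B, S^k L) is
   Tor_(k+1)(B, L) = 0. So k-th syzygies are in GF BB ([GF_syz]).

   No derived functor is constructed. [Tor1_zero B M] says that B ⊗ - keeps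
   monomorphisms with cokernel M injective, and everything rests on one 3 x 3
   diagram chase ([grid_inj]). It shows that this condition can be tested on a
   single flat cover of either variable, and that a syzygy may be moved from one
   variable to the other ([Tor1_shift]). *)

(** * Kernels, cokernels and factorizations *)

Definition mklin (R : pzRingType) (X Y : lmodType R) (f : X -> Y)
  (fL : linear f) : {linear X -> Y} :=
  HB.pack f (GRing.isLinear.Build R X Y *:%R f fL).

Definition mkadd (X Y : zmodType) (f : X -> Y) (fA : zmod_morphism f) :
  {additive X -> Y} := HB.pack f (GRing.isZmodMorphism.Build X Y f fA).

Definition onto (X Y : Type) (f : X -> Y) := forall y, exists x, f x = y.

Lemma injectiveP0 (X Y : zmodType) (f : {additive X -> Y}) :
  (forall x, f x = 0 -> x = 0) -> injective f.
Proof.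
move=> h x y /eqP; rewrite -subr_eq0 -raddfB => /eqP /h /eqP.
by rewrite subr_eq0 => /eqP.
Qed.

Lemma inj0P (X Y : zmodType) (f : {additive X -> Y}) x :
  injective f -> f x = 0 -> x = 0.
Proof. by move=> fi fx; apply: fi; rewrite fx raddf0. Qed.

Definition short_exact (R : pzRingType) (K G M : lmodType R)
  (f : {linear K -> G}) (g : {linear G -> M}) :=
  [/\ injective f, exact_at f g & onto g].

Section Ker.
Variables (R : pzRingType) (G M : lmodType R) (g : {linear G -> M}).
Definition ker_pred : {pred G} := fun x => g x == 0.
Lemma ker_pred_closed : submod_closed ker_pred.
Proof.
split; first by rewrite /in_mem /= /ker_pred linear0.
move=> a x y; rewrite /in_mem /= /ker_pred => /eqP gx /eqP gy.
by rewrite linearP gx gy scaler0 addr0.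
Qed.
HB.instance Definition _ := GRing.isSubmodClosed.Build R G ker_pred ker_pred_closed.
Definition kernel := {x : G | x \in ker_pred}.
HB.instance Definition _ := SubChoice.on kernel.
HB.instance Definition _ := [SubChoice_isSubLmodule of kernel by <:].
Definition kernel_incl : {linear kernel -> G} :=
  mklin (fun a (x y : kernel) => linearP (val : {linear kernel -> G}) a x y).
Lemma kernel_incl_inj : injective kernel_incl.
Proof. exact: val_inj. Qed.
Lemma kernel_incl_exact : exact_at kernel_incl g.
Proof.
move=> b; split=> [gb|[x <-]]; last exact/eqP/(valP x).
have h : b \in ker_pred by rewrite unfold_in; apply/eqP.
by exists (exist _ b h : kernel).
Qed.
End Ker.

Lemma ex_ker (R : pzRingType) (G M : lmodType R) (g : {linear G -> M}) :
  exists (K : lmodType R) (f : {linear K -> G}), injective f /\ exact_at f g.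
Proof.
exists (kernel g), (kernel_incl g).
by split; [exact: kernel_incl_inj|exact: kernel_incl_exact].
Qed.

Section AddCoker.
Variables (K G : zmodType) (f : {additive K -> G}).
Definition im_pred : {pred G} := fun y => `[< exists x, f x = y >].
Lemma im_pred_closed : zmod_closed im_pred.
Proof.
split; first by apply/asboolP; exists 0; rewrite raddf0.
move=> _ _ /asboolP[x <-] /asboolP[y <-]; apply/asboolP.
by exists (x - y); rewrite raddfB.
Qed.
HB.instance Definition _ := GRing.isZmodClosed.Build G im_pred im_pred_closed.
Definition add_coker : Type := Quotient.quot im_pred.
HB.instance Definition _ := GRing.Zmodule.on add_coker.
Definition add_coker_pi (x : G) : add_coker := \pi_(Quotient.quot im_pred)%qT x.
Lemma add_coker_pi_zmod : zmod_morphism add_coker_pi.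
Proof. exact: (raddfB \pi_(Quotient.quot im_pred)%qT). Qed.
HB.instance Definition _ :=
  GRing.isZmodMorphism.Build G add_coker add_coker_pi add_coker_pi_zmod.
Lemma add_coker_pi_exact : exact_at f add_coker_pi.
Proof.
move=> x; rewrite -(raddf0 add_coker_pi); split.
  by move=> /eqP; rewrite -Quotient.idealrBE subr0 => /asboolP.
by move=> h; apply/eqP; rewrite -Quotient.idealrBE subr0; apply/asboolP.
Qed.
Lemma add_coker_pi_surj : onto add_coker_pi.
Proof. by move=> q; exists (repr (q : Quotient.quot im_pred)); apply: reprK. Qed.
End AddCoker.

Lemma ex_add_coker (K G : zmodType) (f : {additive K -> G}) :
  exists (M : zmodType) (g : {additive G -> M}), exact_at f g /\ onto g.
Proof.
exists (add_coker f), (@add_coker_pi _ _ f).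
by split; [exact: add_coker_pi_exact|exact: add_coker_pi_surj].
Qed.

Section Coker.
Variables (R : pzRingType) (K G : lmodType R) (f : {linear K -> G}).
Definition coker : Type := add_coker f.
HB.instance Definition _ := GRing.Zmodule.on coker.
Let pi : {additive G -> coker} := @add_coker_pi _ _ f.
Let pi_surj : onto pi := @add_coker_pi_surj _ _ f.
Definition coker_scale (r : R) (q : coker) : coker := pi (r *: sval (cid (pi_surj q))).
Lemma coker_scaleE r x : coker_scale r (pi x) = pi (r *: x).
Proof.
rewrite /coker_scale; case: cid => y /= yx.
apply/eqP; rewrite -subr_eq0 -raddfB -scalerBr; apply/eqP/(@add_coker_pi_exact _ _ f).
have /(@add_coker_pi_exact _ _ f)[z fz] : pi (y - x) = 0.
  by rewrite raddfB [pi y]yx subrr.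
by exists (r *: z); rewrite -fz; apply: linearZ.
Qed.
Lemma coker_scaleA a b q : coker_scale a (coker_scale b q) = coker_scale (a * b) q.
Proof. by have [x <-] := pi_surj q; rewrite !coker_scaleE scalerA. Qed.
Lemma coker_scale1 q : coker_scale 1 q = q.
Proof. by have [x <-] := pi_surj q; rewrite !coker_scaleE scale1r. Qed.
Lemma coker_scaleDr : right_distributive coker_scale +%R.
Proof.
move=> a p q; have [x <-] := pi_surj p; have [y <-] := pi_surj q.
by rewrite -raddfD !coker_scaleE scalerDr raddfD.
Qed.
Lemma coker_scaleDl q : {morph coker_scale^~ q : a b / a + b}.
Proof.
by move=> a b; have [x <-] := pi_surj q; rewrite !coker_scaleE scalerDl raddfD.
Qed.
HB.instance Definition _ := GRing.Zmodule_isLmodule.Build R coker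
  coker_scaleA coker_scale1 coker_scaleDr coker_scaleDl.
Lemma ex_coker :
  exists (M : lmodType R) (g : {linear G -> M}), exact_at f g /\ onto g.
Proof.
have L : linear (pi : G -> coker).
  by move=> a x y; rewrite raddfD; congr (_ + _); rewrite -coker_scaleE.
exists coker, (mklin L); split; [exact: add_coker_pi_exact|exact: add_coker_pi_surj].
Qed.
End Coker.

Lemma epi_factor (R : pzRingType) (X Y E : lmodType R) (s : {linear X -> Y})
    (f : {linear X -> E}) :
  onto s -> (forall x, s x = 0 -> f x = 0) ->
  exists h : {linear Y -> E}, forall x, h (s x) = f x.
Proof.
move=> /choice[t tK] fs.
have ft x : f (t (s x)) = f x.
  by apply/eqP; rewrite -subr_eq0 -linearB; apply/eqP/fs; rewrite linearB tK subrr.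
have L : linear (f \o t).
  by move=> a y z /=; rewrite -linearP -[in RHS]ft linearP !tK.
by exists (mklin L).
Qed.

Lemma mono_factor (R : pzRingType) (X Y E : lmodType R) (i : {linear X -> Y})
    (f : {linear E -> Y}) :
  injective i -> (forall e, exists x, i x = f e) ->
  exists h : {linear E -> X}, forall e, i (h e) = f e.
Proof.
move=> ii /choice[t tK].
have L : linear t by move=> a y z; apply: ii; rewrite linearP !tK linearP.
by exists (mklin L).
Qed.

Lemma ex_image (R : pzRingType) (X Y : lmodType R) (f : {linear X -> Y}) :
  exists (I : lmodType R) (s : {linear X -> I}) (i : {linear I -> Y}),
    [/\ onto s, injective i & forall x, i (s x) = f x].
Proof.
have [C [q [qe _]]] := ex_coker f; have [I [i [ii ie]]] := ex_ker q.
have [|s sE] := @mono_factor _ _ _ _ i f ii.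
  by move=> x; apply/ie/qe; exists x.
exists I, s, i; split=> // y.
have [x fx] := (qe (i y)).1 ((ie _).2 (ex_intro _ y erefl)).
by exists x; apply: ii; rewrite sE.
Qed.

(** * Right exactness of the tensor product *)

(** The arrow points to the side on which the functor takes its argument:
   B ⊗> f is the map induced by f between B ⊗ K and B ⊗ G, and f <⊗ M the one
   between A ⊗ M and P ⊗ M. *)
Notation "B ⊗> f" := (tens_map (idfun : {linear B -> B}) f)
  (at level 35, f at level 35).
Notation "f <⊗ M" := (tens_map f (idfun : {linear M -> M}))
  (at level 35, M at level 35).

Section Tensor.
Variable R : pzRingType.
Implicit Types (A B P : lmodType R^c) (K G M : lmodType R).

Lemma tensorDl B M (b b' : B) (m : M) :
  tensor (b + b') m = tensor b m + tensor b' m.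
Proof. by case: (tensor_balanced B M). Qed.
Lemma tensorDr B M (b : B) (m m' : M) :
  tensor b (m + m') = tensor b m + tensor b m'.
Proof. by case: (tensor_balanced B M). Qed.
Lemma tensorZ B M (r : R) (b : B) (m : M) :
  tensor ((r : R^c) *: b) m = tensor b (r *: m).
Proof. by case: (tensor_balanced B M). Qed.
Lemma tensor0l B M (m : M) : tensor (0 : B) m = 0.
Proof. by apply: (addrI (tensor 0 m)); rewrite -tensorDl !addr0. Qed.
Lemma tensor0r B M (b : B) : tensor b (0 : M) = 0.
Proof. by apply: (addrI (tensor b 0)); rewrite -tensorDr !addr0. Qed.
Lemma tensorBl B M (b b' : B) (m : M) :
  tensor (b - b') m = tensor b m - tensor b' m.
Proof. by apply: (addIr (tensor b' m)); rewrite -tensorDl !subrK. Qed.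
Lemma tensorBr B M (b : B) (m m' : M) :
  tensor b (m - m') = tensor b m - tensor b m'.
Proof. by apply: (addIr (tensor b m')); rewrite -tensorDr !subrK. Qed.

Lemma tens_ext B M (V : zmodType) (u v : {additive tens B M -> V}) :
  (forall b m, u (tensor b m) = v (tensor b m)) -> u =1 v.
Proof.
move=> uv x; pose h b m := v (tensor b m).
have hb : balanced h.
  by split=> *; rewrite /h ?tensorDl ?tensorDr ?tensorZ ?raddfD.
by rewrite (tens_lift_unique hb uv) -(tens_lift_unique hb (k := v)).
Qed.

Lemma ex_lift B M (V : zmodType) (h : B -> M -> V) : balanced h ->
  exists u : {additive tens B M -> V}, forall b m, u (tensor b m) = h b m.
Proof.
move=> hb; exists (mkadd (tens_lift_zmod_morphism hb)) => b m.
exact: tens_liftE.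
Qed.

Lemma tens_map_swap A B M G (f : {linear A -> B}) (g : {linear M -> G}) x :
  tens_map (idfun : {linear B -> B}) g (tens_map f (idfun : {linear M -> M}) x) =
  tens_map f (idfun : {linear G -> G}) (tens_map (idfun : {linear A -> A}) g x).
Proof.
pose u : {additive tens A M -> tens B G} := (B ⊗> g) \o (f <⊗ M).
pose v : {additive tens A M -> tens B G} := (f <⊗ G) \o (A ⊗> g).
by apply: (@tens_ext _ _ _ u v) => b m; rewrite /u /v /= !tens_mapE.
Qed.

Lemma tens_map_compr B K G M (f : {linear K -> G}) (g : {linear G -> M})
    (k : {linear K -> M}) : (forall x, g (f x) = k x) ->
  forall x, (B ⊗> g) ((B ⊗> f) x) = (B ⊗> k) x.
Proof.
move=> gf; pose u : {additive tens B K -> tens B M} := (B ⊗> g) \o (B ⊗> f).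
apply: (@tens_ext _ _ _ u (B ⊗> k)) => b m.
by rewrite /u /= !tens_mapE /= gf.
Qed.

Lemma tens_map_compl A P B M (f : {linear A -> P}) (g : {linear P -> B})
    (k : {linear A -> B}) : (forall x, g (f x) = k x) ->
  forall x, (g <⊗ M) ((f <⊗ M) x) = (k <⊗ M) x.
Proof.
move=> gf; pose u : {additive tens A M -> tens B M} := (g <⊗ M) \o (f <⊗ M).
apply: (@tens_ext _ _ _ u (k <⊗ M)) => b m.
by rewrite /u /= !tens_mapE /= gf.
Qed.

Lemma tens_map_0r B K M (f : {linear K -> M}) : (forall x, f x = 0) ->
  forall x, (B ⊗> f) x = 0.
Proof.
move=> f0; apply: (@tens_ext _ _ _ (B ⊗> f) \0) => b m.
by rewrite /= tens_mapE f0 tensor0r.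
Qed.

Lemma tens_map_0l A B M (f : {linear A -> B}) : (forall x, f x = 0) ->
  forall x, (f <⊗ M) x = 0.
Proof.
move=> f0; apply: (@tens_ext _ _ _ (f <⊗ M) \0) => b m.
by rewrite /= tens_mapE f0 tensor0l.
Qed.

(** The cokernel of u receives the zero map from all tensors, and a map out of
   B ⊗ M is determined by its values on tensors. *)
Lemma tens_surj_gen B M (V : zmodType) (u : {additive V -> tens B M}) :
  (forall b m, exists v, u v = tensor b m) -> onto u.
Proof.
move=> ut x; have [Q [q [qe _]]] := ex_add_coker u.
apply/qe; apply: (@tens_ext _ _ _ q \0) => b m; exact/qe/ut.
Qed.

(** The inverse of the map from the cokernel of f <⊗ M to B ⊗ M sends a tensor
   b ⊗ m to the class of p ⊗ m for any preimage p of b. *)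
Lemma tens_right_exact_left A P B M (f : {linear A -> P}) (g : {linear P -> B}) :
  exact_at f g -> onto g -> exact_at (f <⊗ M) (g <⊗ M) /\ onto (g <⊗ M).
Proof.
move=> fg gs; split; last first.
  apply: tens_surj_gen => b m; have [p <-] := gs b.
  by exists (tensor p m); rewrite /= tens_mapE.
move=> x; split=> [gx|[y <-]]; last first.
  rewrite (@tens_map_compl _ _ _ _ f g \0) ?tens_map_0l // => z.
  by apply/fg; exists z.
have [Q [q [qe qs]]] := ex_add_coker (f <⊗ M); apply/qe.
have [s sK] := choice gs.
have qE p p' m : g p = g p' -> q (tensor p m) = q (tensor p' m).
  move=> /eqP; rewrite -subr_eq0 -linearB => /eqP /fg [a fa].
  apply/eqP; rewrite -subr_eq0 -raddfB -tensorBl -fa; apply/eqP/qe.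
  by exists (tensor a m); rewrite /= tens_mapE.
have [|u uE] := @ex_lift B M Q (fun b m => q (tensor (s b) m)).
  split=> [b b' m|b m m'|r b m].
  - by rewrite -raddfD -tensorDl; apply: qE; rewrite linearD !sK.
  - by rewrite tensorDr raddfD.
  - by rewrite -tensorZ; apply: qE; rewrite linearZ !sK.
have /(_ x) : (u \o (g <⊗ M) : {additive _ -> _}) =1 q.
  by apply: tens_ext => p m /=; rewrite tens_mapE uE; apply: qE; rewrite sK.
by move=> /= <-; rewrite gx raddf0.
Qed.

Lemma tens_right_exact_right B K G M (f : {linear K -> G}) (g : {linear G -> M}) :
  exact_at f g -> onto g -> exact_at (B ⊗> f) (B ⊗> g) /\ onto (B ⊗> g).
Proof.
move=> fg gs; split; last first.
  apply: tens_surj_gen => b m; have [p <-] := gs m.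
  by exists (tensor b p); rewrite /= tens_mapE.
move=> x; split=> [gx|[y <-]]; last first.
  rewrite (@tens_map_compr _ _ _ _ f g \0) ?tens_map_0r // => z.
  by apply/fg; exists z.
have [Q [q [qe qs]]] := ex_add_coker (B ⊗> f); apply/qe.
have [s sK] := choice gs.
have qE b p p' : g p = g p' -> q (tensor b p) = q (tensor b p').
  move=> /eqP; rewrite -subr_eq0 -linearB => /eqP /fg [a fa].
  apply/eqP; rewrite -subr_eq0 -raddfB -tensorBr -fa; apply/eqP/qe.
  by exists (tensor b a); rewrite /= tens_mapE.
have [|u uE] := @ex_lift B M Q (fun b m => q (tensor b (s m))).
  split=> [b b' m|b m m'|r b m].
  - by rewrite tensorDl raddfD.
  - by rewrite -raddfD -tensorDr; apply: qE; rewrite linearD !sK.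
  - by rewrite tensorZ; apply: qE; rewrite linearZ !sK.
have /(_ x) : (u \o (B ⊗> g) : {additive _ -> _}) =1 q.
  by apply: tens_ext => b m /=; rewrite tens_mapE uE; apply: qE; rewrite sK.
by move=> /= <-; rewrite gx raddf0.
Qed.
End Tensor.

(** * A diagram chase in a 3 x 3 grid *)

(** The chase moves from X31 to X13 along the diagonal of the grid
[[
   X11 -> X12 -> X13
    |      |      |
   X21 -> X22 -> X23
    |      |
   X31 -> X32
]]
   and back: an element killed by r31 lifts to X21, its image in X22 comes from
   X12 and dies in X13, so it comes from X11. The hypotheses are stated for one
   of the two symmetric readings of a grid of tensor products; the other is
   obtained by exchanging rows and columns. *)
Lemma grid_inj (X11 X12 X13 X21 X22 X31 X32 X23 : zmodType)
  (r11 : {additive X11 -> X12}) (r12 : {additive X12 -> X13})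
  (r21 : {additive X21 -> X22}) (r22 : {additive X22 -> X23})
  (r31 : {additive X31 -> X32})
  (c11 : {additive X11 -> X21}) (c21 : {additive X21 -> X31})
  (c12 : {additive X12 -> X22}) (c22 : {additive X22 -> X32})
  (c13 : {additive X13 -> X23}) :
  (forall x, r21 (c11 x) = c12 (r11 x)) ->
  (forall x, r31 (c21 x) = c22 (r21 x)) ->
  (forall x, r22 (c12 x) = c13 (r12 x)) ->
  exact_at r11 r12 -> (forall x, r22 (r21 x) = 0) ->
  exact_at c12 c22 -> (forall x, c21 (c11 x) = 0) -> onto c21 ->
  injective r21 -> injective c13 -> injective r31.
Proof.
move=> sq1 sq2 sq3 ex1 z2 exc zc cs r21i c13i; apply: injectiveP0 => x rx.
have [y yx] := cs x.
have /exc[w wy] : c22 (r21 y) = 0 by rewrite -sq2 yx.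
have /ex1[v vw] : r12 w = 0 by apply: (inj0P c13i); rewrite -sq3 wy z2.
by rewrite -yx -[y](r21i (c11 v)) ?zc // sq1 vw.
Qed.

Section Grid.
Variable R : pzRingType.
Variables (A P B : lmodType R^c) (K G M : lmodType R).
Variables (a : {linear A -> P}) (p : {linear P -> B}).
Variables (f : {linear K -> G}) (g : {linear G -> M}).
Hypotheses (hr : short_exact a p) (hl : short_exact f g).

Lemma tens_grid_right :
  injective (P ⊗> f) -> injective (a <⊗ M) -> injective (B ⊗> f).
Proof.
case: hr hl => _ ap ps [_ fg gs] h1 h2.
have [ex1 s1] := tens_right_exact_right A fg gs.
have [ex2 s2] := tens_right_exact_right P fg gs.
have [ec1 t1] := tens_right_exact_left K ap ps.
have [ec2 t2] := tens_right_exact_left G ap ps.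
apply: (@grid_inj _ _ _ _ _ _ _ _
  (A ⊗> f) (A ⊗> g) (P ⊗> f) (P ⊗> g) (B ⊗> f)
  (a <⊗ K) (p <⊗ K) (a <⊗ G) (p <⊗ G) (a <⊗ M)) => //;
  try by move=> x; (exact: tens_map_swap || exact/esym/tens_map_swap).
- by move=> x; apply/ex2; exists x.
- by move=> x; apply/ec1; exists x.
Qed.

Lemma tens_grid_left :
  injective (a <⊗ G) -> injective (B ⊗> f) -> injective (a <⊗ M).
Proof.
case: hr hl => _ ap ps [_ fg gs] h1 h2.
have [ex1 s1] := tens_right_exact_right A fg gs.
have [ex2 s2] := tens_right_exact_right P fg gs.
have [ec1 t1] := tens_right_exact_left K ap ps.
have [ec2 t2] := tens_right_exact_left G ap ps.
apply: (@grid_inj _ _ _ _ _ _ _ _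
  (a <⊗ K) (p <⊗ K) (a <⊗ G) (p <⊗ G) (a <⊗ M)
  (A ⊗> f) (A ⊗> g) (P ⊗> f) (P ⊗> g) (B ⊗> f)) => //;
  try by move=> x; (exact: tens_map_swap || exact/esym/tens_map_swap).
- by move=> x; apply/ec2; exists x.
- by move=> x; apply/ex1; exists x.
Qed.
End Grid.

(** * Free modules *)

Section MalgLift.
Variables (S : choiceType) (A V : zmodType) (h : S -> {additive A -> V}).
Definition malg_lift (y : {malg A[S]}) : V := \sum_(k <- msupp y) h k (mcoeff k y).
Lemma malg_liftw (D : {fset S}) (y : {malg A[S]}) : (msupp y `<=` D)%fset ->
  malg_lift y = \sum_(k <- D) h k (mcoeff k y).
Proof.
move=> yD; apply: big_fset_incl => // k _ /mcoeff_outdom ->; exact: raddf0.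
Qed.
Lemma malg_lift_zmod : zmod_morphism malg_lift.
Proof.
move=> x y; pose D := (msupp x `|` msupp y)%fset.
rewrite (@malg_liftw D (x - y)) ?msuppB_le // (@malg_liftw D x) ?fsubsetUl //.
rewrite (@malg_liftw D y) ?fsubsetUr // -sumrB; apply: eq_bigr => k _.
by rewrite mcoeffB raddfB.
Qed.
HB.instance Definition _ := GRing.isZmodMorphism.Build _ _ malg_lift malg_lift_zmod.
Lemma malg_liftU k a : malg_lift (mkmalgU k a) = h k a.
Proof.
by rewrite (@malg_liftw [fset k]%fset) ?msuppU_le // big_seq_fset1 mcoeffUU.
Qed.
End MalgLift.

Section Free.
Variables (R : pzRingType) (S : choiceType).
(** R is only a pzRingType, so the zero ring is included; the finitely supported
   functions of [malg] form an additive group over any R, and the scalar action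
   is added here. *)
Definition freemod : Type := {malg R[S]}.
HB.instance Definition _ := GRing.Zmodule.on freemod.
Implicit Types x : freemod.
Definition frscale (c : R) (x : freemod) : freemod :=
  [malg k in msupp x => c * mcoeff k x].
Lemma frscaleE c x k : mcoeff k (frscale c x) = c * mcoeff k x.
Proof. by rewrite mcoeffE; case: msuppP; rewrite ?mulr0. Qed.
Lemma frscaleA c1 c2 x : frscale c1 (frscale c2 x) = frscale (c1 * c2) x.
Proof. by apply/malgP => k; rewrite !frscaleE mulrA. Qed.
Lemma frscale1 x : frscale 1 x = x.
Proof. by apply/malgP => k; rewrite !frscaleE mul1r. Qed.
Lemma frscaleDr : right_distributive frscale +%R.
Proof. by move=> c x y; apply/malgP => k; rewrite !(mcoeffD,frscaleE) mulrDr. Qed.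
Lemma frscaleDl x : {morph frscale^~ x : a b / a + b}.
Proof. by move=> a b; apply/malgP => k; rewrite !(mcoeffD,frscaleE) mulrDl. Qed.
HB.instance Definition _ := GRing.Zmodule_isLmodule.Build R freemod
  frscaleA frscale1 frscaleDr frscaleDl.

Definition free_gen (k : S) : freemod := mkmalgU k 1.

Lemma free_expand x :
  x = \sum_(k <- msupp (x : {malg R[S]})) mcoeff k x *: free_gen k.
Proof.
rewrite [LHS]monalgE; apply: eq_bigr => k _; apply/malgP => l.
by rewrite frscaleE !mcoeffU mulrnAr mulr1.
Qed.

Lemma free_lift (M : lmodType R) (f : S -> M) :
  exists h : {linear freemod -> M}, forall k, h (free_gen k) = f k.
Proof.
have aD k : zmod_morphism (fun a : R => a *: f k).
  by move=> a b; rewrite scalerBl.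
pose g k := mkadd (aD k).
have L : linear (malg_lift g : freemod -> M).
  move=> c x y; rewrite raddfD; congr (_ + _).
  rewrite [LHS](@malg_liftw _ _ _ g (msupp (x : {malg R[S]})) (c *: x)).
    rewrite /malg_lift scaler_sumr; apply: eq_bigr => k _.
    by rewrite /= frscaleE scalerA.
  apply/fsubsetP => k; rewrite -!mcoeff_neq0 frscaleE.
  by apply: contra_neq => ->; rewrite mulr0.
by exists (mklin L) => k; rewrite /= malg_liftU /= scale1r.
Qed.

Lemma free_projective : projective freemod.
Proof.
move=> A B g f gs; have [s sK] := choice gs.
have [h hE] := free_lift (fun k => s (f (free_gen k))).
exists h => x; rewrite [x]free_expand !linear_sum; apply: eq_bigr => k _.
by rewrite !linearZ hE sK.
Qed.

(** The free module R^(S) tensored with A is the direct sum A^(S), realized as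
   the finitely supported functions S -> A. *)
Lemma free_tens (A : lmodType R^c) :
  exists phi : {additive tens A freemod -> {malg A[S]}}, injective phi /\
    forall a x k, mcoeff k (phi (tensor a x)) = (mcoeff k x : R^c) *: a.
Proof.
pose h (a : A) (x : freemod) : {malg A[S]} :=
  [malg k in msupp x => (mcoeff k x : R^c) *: a].
have hE a x k : mcoeff k (h a x) = (mcoeff k x : R^c) *: a.
  by rewrite mcoeffE; case: msuppP; rewrite ?scale0r.
have [|phi phiE] := @ex_lift R A freemod _ h.
  split=> [b b' m|b m m'|r b m]; apply/malgP => k; rewrite !(mcoeffD,hE).
  - by rewrite scalerDr.
  - by rewrite scalerDl.
  - by rewrite scalerA frscaleE.
exists phi; split; last by move=> a x k; rewrite phiE hE.
have tD k : zmod_morphism (fun a : A => tensor a (free_gen k)).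
  by move=> a b; rewrite tensorBl.
pose g k := mkadd (tD k).
have us : onto (malg_lift g).
  apply: tens_surj_gen => a x; exists (h a x).
  rewrite /= (@malg_liftw _ _ _ g (msupp (x : {malg R[S]})) (h a x)).
    pose t := mkadd (fun m m' : freemod => tensorBr a m m').
    rewrite [X in tensor a X]free_expand -[tensor a _]/(t _) raddf_sum.
    apply: eq_bigr => k _.
    by rewrite /= hE tensorZ.
  apply/fsubsetP => k; rewrite -!mcoeff_neq0 hE.
  by apply: contra_neq => ->; rewrite scale0r.
have phiK y : phi (malg_lift g y) = y.
  rewrite /malg_lift raddf_sum [RHS]monalgE; apply: eq_bigr => k _ /=.
  apply/malgP => l; rewrite phiE hE !mcoeffU.
  by case: eqP; rewrite ?scale1r ?scale0r.
by move=> x y; have [u <-] := us x; have [v <-] := us y; rewrite !phiK => ->.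
Qed.

(** A map between direct sums that acts as f on each coordinate is injective
   when f is. *)
Lemma free_tens_inj (A B : lmodType R^c) (f : {linear A -> B}) :
  injective f -> injective (f <⊗ freemod).
Proof.
move=> fi; have [pA [pAi pAE]] := free_tens A; have [pB [pBi pBE]] := free_tens B.
apply: injectiveP0 => x fx; apply: (inj0P pAi); apply/malgP => k; rewrite ?mcoeff0.
apply: (inj0P fi); transitivity (mcoeff k (pB ((f <⊗ freemod) x))); last first.
  by rewrite fx !raddf0.
pose u : {additive tens A freemod -> B} := (f \o mcoeff k) \o pA.
pose v : {additive tens A freemod -> B} := mcoeff k \o (pB \o (f <⊗ freemod)).
apply: (@tens_ext _ _ _ _ u v) => a m; rewrite /u /v /= pAE tens_mapE pBE.
exact: linearZ.
Qed.

End Free.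

(** * Flatness on either side *)

(** An exact A -> B -> C factors through the image I of B -> C. Right exactness
   handles A -> B -> I, and the injection of I in C is kept by hypothesis. *)
Lemma flatP (R : pzRingType) (F : lmodType R) :
  flat F <-> forall (A B : lmodType R^c) (f : {linear A -> B}),
    injective f -> injective (f <⊗ F).
Proof.
split=> [fF A B f fi|fF A B C f g fg].
  apply: injectiveP0 => x; pose z : {linear A -> A} := \0.
  have zf : exact_at z f.
    move=> a; split=> [/(inj0P fi) ->|[b <-]]; last by rewrite linear0.
    by exists 0; rewrite linear0.
  by move=> /(fF _ _ _ z f zf)[y <-]; rewrite tens_map_0l.
have [I [s [i [ss ii isE]]]] := ex_image g.
have fs : exact_at f s.
  move=> b; split=> [sb|/fg]; first by apply/fg; rewrite -isE sb linear0.
  by rewrite -isE => /(inj0P ii).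
move=> x; have <- := (tens_right_exact_left F fs ss).1 x.
rewrite -(tens_map_compl isE); split=> [|->]; last by rewrite raddf0.
exact/inj0P/fF.
Qed.

(** Flatness of a right module B, that is of a left module over R^c, speaks of
   right modules over R^c, hence of left modules over R^c^c and of tensor
   products with B in the second place. The rings R^c^c and R have the same
   operations but are not convertible. The carrier of a module over one of them
   is made a module over the other, and [tens_flip] exchanges the factors. *)
Section ConverseConverse.
Variable R : pzRingType.
Definition up_cc (M : lmodType R) : Type := M.
Section Up.
Variable M : lmodType R.
HB.instance Definition _ := GRing.Zmodule.on (up_cc M).
Definition up_scale (r : R^c^c) (m : up_cc M) : up_cc M := (r : R) *: (m : M).
Lemma up_scaleA a b m : up_scale a (up_scale b m) = up_scale (a * b) m.
Proof. exact: scalerA. Qed.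
Lemma up_scale1 m : up_scale 1 m = m. Proof. exact: scale1r. Qed.
Lemma up_scaleDr : right_distributive up_scale +%R.
Proof. by move=> a x y; apply: (@scalerDr R M). Qed.
Lemma up_scaleDl m : {morph up_scale^~ m : a b / a + b}.
Proof. by move=> a b; apply: scalerDl. Qed.
HB.instance Definition _ := GRing.Zmodule_isLmodule.Build R^c^c (up_cc M)
  up_scaleA up_scale1 up_scaleDr up_scaleDl.
End Up.
Definition down_cc (M : lmodType R^c^c) : Type := M.
Section Down.
Variable M : lmodType R^c^c.
HB.instance Definition _ := GRing.Zmodule.on (down_cc M).
Definition down_scale (r : R) (m : down_cc M) : down_cc M := (r : R^c^c) *: (m : M).
Lemma down_scaleA a b m : down_scale a (down_scale b m) = down_scale (a * b) m.
Proof. exact: (@scalerA R^c^c). Qed.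
Lemma down_scale1 m : down_scale 1 m = m. Proof. exact: (@scale1r R^c^c). Qed.
Lemma down_scaleDr : right_distributive down_scale +%R.
Proof. by move=> a x y; apply: (@scalerDr R^c^c M). Qed.
Lemma down_scaleDl m : {morph down_scale^~ m : a b / a + b}.
Proof. by move=> a b; apply: (@scalerDl R^c^c). Qed.
HB.instance Definition _ := GRing.Zmodule_isLmodule.Build R (down_cc M)
  down_scaleA down_scale1 down_scaleDr down_scaleDl.
End Down.

Lemma tens_flip (B : lmodType R^c) (M : lmodType R) (X : lmodType R^c^c)
    (phi : {additive M -> X}) (psi : X -> M) :
  cancel phi psi -> cancel psi phi ->
  (forall (r : R) m, phi (r *: m) = (r : R^c^c) *: phi m) ->
  exists theta : {additive tens B M -> tens X B},
    [/\ injective theta, onto theta &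
      forall b m, theta (tensor b m) = tensor (phi m) b].
Proof.
move=> phiK psiK phiZ.
have psiD x y : psi (x + y) = psi x + psi y.
  by apply: (can_inj phiK); rewrite psiK raddfD !psiK.
have psiZ (r : R^c^c) x : psi (r *: x) = (r : R) *: psi x.
  by apply: (can_inj phiK); rewrite psiK phiZ psiK.
have [|t tE] := @ex_lift R B M _ (fun b m => tensor (phi m) b).
  split=> [b b' m|b m m'|r b m].
  - by rewrite tensorDr.
  - by rewrite raddfD tensorDl.
  - by rewrite phiZ; apply/esym/(@tensorZ R^c).
have [|u uE] := @ex_lift R^c X B _ (fun x b => tensor b (psi x)).
  split=> [b b' m|b m m'|r b m].
  - by rewrite psiD tensorDr.
  - by rewrite tensorDl.
  - by rewrite psiZ tensorZ.
exists t; split=> //.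
  apply: (@can_inj _ _ _ u) => x.
  by apply: (@tens_ext _ _ _ _ (u \o t) idfun) => b m /=; rewrite tE uE phiK.
move=> x; exists (u x).
by apply: (@tens_ext _ _ _ _ (t \o u) idfun) => y b /=; rewrite uE tE psiK.
Qed.

Lemma flat_rightP (P : lmodType R^c) :
  flat P <-> forall (K G : lmodType R) (f : {linear K -> G}),
    injective f -> injective (P ⊗> f).
Proof.
rewrite flatP; split=> [fP K G f fi|fP X Y f fi].
  pose phi (M : lmodType R) := mkadd (fun x y : M => erefl ((x - y : M) : up_cc M)).
  have L : linear (f : up_cc K -> up_cc G) by move=> a x y; apply: linearP.
  have [u [ui _ uE]] :=
    @tens_flip P K (up_cc K) (phi K) id (frefl _) (frefl _) (fun _ _ => erefl).
  have [v [vi _ vE]] :=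
    @tens_flip P G (up_cc G) (phi G) id (frefl _) (frefl _) (fun _ _ => erefl).
  have E x : v ((P ⊗> f) x) = (mklin L <⊗ P) (u x).
    apply: (@tens_ext _ _ _ _ (v \o (P ⊗> f)) ((mklin L <⊗ P) \o u)) => b m /=.
    by rewrite uE !tens_mapE vE.
  apply: injectiveP0 => x fx.
  have : (mklin L <⊗ P) (u x) = 0 by rewrite -E fx raddf0.
  by move/(inj0P (fP _ _ (mklin L) fi))/(inj0P ui).
pose phi (M : lmodType R^c^c) :=
  mkadd (fun x y : down_cc M => erefl ((x - y : down_cc M) : M)).
have L : linear (f : down_cc X -> down_cc Y) by move=> a x y; apply: (@linearP R^c^c).
have [u [_ us uE]] :=
  @tens_flip P (down_cc X) X (phi X) id (frefl _) (frefl _) (fun _ _ => erefl).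
have [v [vi _ vE]] :=
  @tens_flip P (down_cc Y) Y (phi Y) id (frefl _) (frefl _) (fun _ _ => erefl).
have E x : v ((P ⊗> mklin L) x) = (f <⊗ P) (u x).
  apply: (@tens_ext _ _ _ _ (v \o (P ⊗> mklin L)) ((f <⊗ P) \o u)) => b m /=.
  by rewrite uE !tens_mapE vE.
apply: injectiveP0 => x; have [y <-] := us x; move=> fx.
have /(inj0P vi) : v ((P ⊗> mklin L) y) = 0 by rewrite E; exact: fx.
by move/(inj0P (fP _ _ (mklin L) fi)) ->; rewrite raddf0.
Qed.
End ConverseConverse.

(** The cover is free on the set of elements of M. Flatness serves for tensor
   products and projectivity for lifting maps in the horseshoe lemma. *)
Lemma ex_cover (R : pzRingType) (M : lmodType R) :
  exists (K F : lmodType R) (f : {linear K -> F}) (g : {linear F -> M}),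
    [/\ short_exact f g, flat F & projective F].
Proof.
have [g gE] := @free_lift R M M id; have [K [f [fi fg]]] := ex_ker g.
exists K, (freemod R M), f, g; split; last exact: free_projective.
  by split=> // m; exists (free_gen R m).
by apply/flatP => A B u; apply: free_tens_inj.
Qed.

(** * Modules with vanishing first Tor group *)

Section Tor1.
Variable R : pzRingType.
Implicit Types (A B P : lmodType R^c) (K G M F : lmodType R).

(** This is the vanishing of Tor_1(B, M), expressed by its effect on all short
   exact sequences that end in M. *)
Definition Tor1_zero B M :=
  forall K G (f : {linear K -> G}) (g : {linear G -> M}),
    short_exact f g -> injective (B ⊗> f).

(** One flat presentation of B suffices: Tor_1(B, M) is the kernel of a <⊗ M as
   soon as P is flat. *)
Lemma Tor1_zero_of_injl A P B M (a : {linear A -> P}) (p : {linear P -> B}) :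
  short_exact a p -> flat P -> injective (a <⊗ M) -> Tor1_zero B M.
Proof.
move=> h /flat_rightP fP ai K G f g fg; apply: (tens_grid_right h fg) => //.
by apply: fP; case: fg.
Qed.

(** The mirror image of the definition: vanishing of Tor_1(B, M) also controls
   the short exact sequences that end in B. *)
Lemma Tor1_zero_injl A P B M (a : {linear A -> P}) (p : {linear P -> B}) :
  Tor1_zero B M -> short_exact a p -> injective (a <⊗ M).
Proof.
move=> t h; have [K [F [f [g [fg /flatP fF _]]]]] := ex_cover M.
by apply: (tens_grid_left h fg); [apply: fF; case: h|apply: t fg].
Qed.

(** In the exact sequence Tor_1(B, G) -> Tor_1(B, M) -> B ⊗ K -> B ⊗ G the first
   term is zero and the last map is injective. *)
Lemma Tor1_zero_of_injr B K G M (f : {linear K -> G}) (g : {linear G -> M}) :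
  short_exact f g -> Tor1_zero B G -> injective (B ⊗> f) -> Tor1_zero B M.
Proof.
move=> fg tG fi; have [A [P [a [p [ap fP _]]]]] := ex_cover B.
apply: (Tor1_zero_of_injl ap) => //; apply: (tens_grid_left ap fg) => //.
exact: Tor1_zero_injl tG ap.
Qed.

Lemma flat_Tor1 F : flat F <-> forall B, Tor1_zero B F.
Proof.
rewrite flatP; split=> [fF B|t A P a ai].
  have [A [P [a [p [ap fP _]]]]] := ex_cover B.
  by apply: (Tor1_zero_of_injl ap) => //; apply: fF; case: ap.
have [B [p [ap ps]]] := ex_coker a.
by apply: (@Tor1_zero_injl _ _ B _ a p).
Qed.

Lemma flat_right_Tor1 P : flat P <-> forall M, Tor1_zero P M.
Proof.
rewrite flat_rightP; split=> [fP M K G f g [fi _ _]|t K G f fi]; first exact: fP.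
have [M [g [fg gs]]] := ex_coker f.
by apply: (t M _ _ f g).
Qed.

(** A ⊗ K -> A ⊗ G is injective because A ⊗ K -> P ⊗ K -> P ⊗ G is: the first
   arrow by Tor_1(B, K) = 0, the second by flatness of P. The kernel of the map
   is the image of Tor_1(A, M), and Tor_1(A, M) is Tor_2(B, M). *)
Lemma Tor1_zero_syz_inj A P B K G M (a : {linear A -> P}) (p : {linear P -> B})
    (f : {linear K -> G}) (g : {linear G -> M}) :
  short_exact a p -> flat P -> short_exact f g -> Tor1_zero B K ->
  injective (A ⊗> f).
Proof.
move=> ap /flat_rightP fP [fi _ _] t x y xy.
apply: (Tor1_zero_injl t ap); apply: (fP _ _ _ fi).
by rewrite !tens_map_swap xy.
Qed.

(** Both conditions say that A ⊗ K -> P ⊗ F is injective; the kernel of this map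
   is Tor_2(B, M). *)
Lemma Tor1_shift A P B K F M (a : {linear A -> P}) (p : {linear P -> B})
    (f : {linear K -> F}) (g : {linear F -> M}) :
  short_exact a p -> flat P -> short_exact f g -> flat F ->
  Tor1_zero B K <-> Tor1_zero A M.
Proof.
move=> ap fP fg fF; split=> t.
  apply: (Tor1_zero_of_injr fg); first by move/flat_Tor1: fF; apply.
  exact: Tor1_zero_syz_inj ap fP fg t.
apply: (Tor1_zero_of_injl ap) => // x y xy.
apply: (t _ _ _ _ fg); move/flatP: fF => /(_ _ _ a)-h.
by apply: h; [case: ap|rewrite -!tens_map_swap xy].
Qed.

Lemma short_exact_iso K G M M' (f : {linear K -> G}) (g : {linear G -> M})
    (h : {linear M -> M'}) : injective h -> onto h -> short_exact f g ->
  short_exact f (h \o g).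
Proof.
move=> hi hs [fi fg gs]; split=> //.
  move=> x /=; split=> [/(inj0P hi)/fg//|[y <-]].
  by rewrite (fg (f y)).2 ?linear0 //; exists y.
by move=> y; have [m <-] := hs y; have [x <-] := gs m; exists x.
Qed.

Lemma iso_inv (S : pzRingType) (M M' : lmodType S) (h : {linear M -> M'}) :
  injective h -> onto h ->
  exists h' : {linear M' -> M},
    [/\ cancel h h', cancel h' h & injective h' /\ onto h'].
Proof.
move=> hi hs; have [h' h'K] := @mono_factor _ _ _ _ h idfun hi hs.
have hK : cancel h h' by move=> x; apply: hi; rewrite h'K.
exists h'; split=> //; split; first exact: can_inj h'K.
by move=> x; exists (h x).
Qed.

Lemma Tor1_zero_iso B M M' (h : {linear M -> M'}) : injective h -> onto h ->
  Tor1_zero B M -> Tor1_zero B M'.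
Proof.
move=> hi hs t K G f g fg; have [h' [_ _ [i s]]] := iso_inv hi hs.
by apply: (t _ _ f (h' \o g)); apply: short_exact_iso.
Qed.

Lemma flat_iso M M' (h : {linear M -> M'}) : injective h -> onto h ->
  flat M -> flat M'.
Proof.
move=> hi hs /flat_Tor1 t; apply/flat_Tor1 => B.
exact: (Tor1_zero_iso hi hs (t B)).
Qed.
End Tor1.

(** * Bounded resolutions, syzygies and higher Tor groups *)

Lemma le_enat_leastP (P : nat -> Prop) k :
  le_enat (enat_least P) (Some k) <-> exists2 j, (j <= k)%N & P j.
Proof.
rewrite /enat_least; case: pselect => [exP|nP] /=.
  split=> [|[j jk Pj]].
    by case: ex_minnP => m /asboolP Pm _ mk; exists m.
  by case: ex_minnP => m _ /(_ j) h; apply: leq_trans jk; apply/h/asboolP.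
by split=> // -[j _ Pj]; apply: nP; exists j; apply/asboolP.
Qed.

Section Resolutions.
Variable R : pzRingType.
Implicit Types (M G K E F L P Q X Z : lmodType R).
Implicit Types (B : lmodType R^c) (C : lmodType R -> Prop).

Lemma ex_zero_module : exists Z : lmodType R, forall z : Z, z = 0.
Proof.
have [Z [f [fi fe]]] := ex_ker (idfun : {linear R^o -> R^o}).
by exists Z => z; apply: (inj0P fi); apply/fe; exists z.
Qed.

(** The resolutions of length k of [has_resolution], cut into short exact
   sequences so that one can induct on k. *)
Fixpoint bounded_resolution C (k : nat) M : Prop :=
  if k is k'.+1 then
    exists (K X : lmodType R) (f : {linear K -> X}) (g : {linear X -> M}),
      [/\ C X, short_exact f g & bounded_resolution C k' K]
  else C M.

Definition iso_closed C := forall M M' (h : {linear M -> M'}),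
  injective h -> onto h -> C M -> C M'.
Definition has_zero C := forall Z : lmodType R, (forall z : Z, z = 0) -> C Z.

Lemma bounded_resolutionS C k M : has_zero C ->
  bounded_resolution C k M -> bounded_resolution C k.+1 M.
Proof.
move=> C0; elim: k M => [|k IH] M /=; last first.
  by move=> [K [X [f [g [CX fg /IH rK]]]]]; exists K, X, f, g.
move=> CM; have [Z Z0] := ex_zero_module.
exists Z, M, \0, idfun; split=> //; last exact: C0.
split=> [x y _|m|m]; first by rewrite (Z0 x) (Z0 y).
  by split=> [/= ->|[z <-]] //; exists 0.
by exists m.
Qed.

Lemma bounded_resolution_leq C j k M : has_zero C -> (j <= k)%N ->
  bounded_resolution C j M -> bounded_resolution C k M.
Proof.
move=> C0 /subnK <-; elim: (_ - _)%N => // i IH /IH; exact: bounded_resolutionS.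
Qed.

Lemma is_resolutionP M (X : augmented M) : is_resolution X <->
  [/\ onto (aug X), exact_at (diff X 0) (aug X) &
      forall i, exact_at (diff X i.+1) (diff X i)].
Proof.
split=> [h|[h1 h2 h3] n]; last by split=> // i _; apply: h3.
split; [by case: (h 0%N)|by case: (h 1%N) => _ /(_ isT)|move=> i].
by case: (h i.+2) => _ _; apply.
Qed.

Lemma has_resolution_bounded C M k : iso_closed C ->
  has_resolution C M k -> bounded_resolution C k M.
Proof.
move=> Ci; elim: k M => [|k IH] M [X [/is_resolutionP[X1 X2 X3] CX X0]] /=.
  apply: (Ci _ _ (aug X)) => //; last exact: CX.
  apply: injectiveP0 => x /X2[y <-]; by rewrite (X0 _ _ y) // linear0.
have [K [f [fi fe]]] := ex_ker (aug X).
have [|s sE] := @mono_factor _ _ _ _ f (diff X 0) fi.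
  by move=> x; apply/fe/X2; exists x.
exists K, (term X 0), f, (aug X); split=> //; first exact: CX.
apply: IH; exists (@Augmented R K (fun i => term X i.+1) (fun i => diff X i.+1) s).
split=> [|i ik|i ik]; [|exact: CX|exact: X0].
apply/is_resolutionP; split=> [y|x|i] /=; last exact: X3.
  have /X2[x xE] : aug X (f y) = 0 by apply/fe; exists y.
  by exists x; apply: fi; rewrite [LHS]sE.
apply: iff_trans (X3 _ _); split=> [sx|dx]; first by rewrite -sE [s x]sx linear0.
by apply: (inj0P fi); rewrite [LHS]sE.
Qed.

Lemma bounded_has_resolution C M k :
  bounded_resolution C k M -> has_resolution C M k.
Proof.
elim: k M => [|k IH] M /=.
  move=> CM; have [Z Z0] := ex_zero_module.
  pose T i := if i is _.+1 then Z else M.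
  pose d i : {linear T i.+1 -> T i} := \0.
  exists (@Augmented R M T d idfun); split=> [|[|i]|[|i]] //=.
  apply/is_resolutionP; split=> [m|m|i x] /=; first by exists m.
    by split=> [/= ->|[z <-]] //; exists 0.
  by split=> // _; exists 0; rewrite /= (Z0 x).
move=> [K [Y [f [g [CY [fi fg gs] /IH]]]]] [X [/is_resolutionP[X1 X2 X3] CX X0]].
pose T i := if i is j.+1 then term X j else Y.
pose d i : {linear T i.+1 -> T i} :=
  if i is j.+1 return {linear T i.+1 -> T i} then diff X j else f \o aug X.
exists (@Augmented R M T d g); split=> [|[|i]|[|i]] //=; [|exact: CX|exact: X0].
apply/is_resolutionP; split=> //= [y|[|i]] /=; last exact: X3.
  apply: iff_trans (fg y) _; split=> [[x <-]|[x <-]]; last by exists (aug X x).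
  by have [z <-] := X1 x; exists z.
move=> x; apply: iff_trans (X2 x); split=> /= [/(inj0P fi)//|->].
exact: linear0.
Qed.

Lemma resolution_dimP C M k : iso_closed C -> has_zero C ->
  le_enat (resolution_dim C M) (Some k) <-> bounded_resolution C k M.
Proof.
move=> Ci C0; rewrite le_enat_leastP; split=> [[j jk /has_resolution_bounded-h]|h].
  by apply: bounded_resolution_leq jk _ => //; apply: h.
by exists k => //; apply: bounded_has_resolution.
Qed.

(** G is a k-th syzygy of M with respect to some flat resolution. The recursion
   adds the last step G -> F -> G' of the resolution, the form in which syzygies
   are used both in [horseshoe] and when they are moved to the other variable;
   [syz_prepend] adds the first step. *)
Fixpoint syz (k : nat) M G : Prop :=
  if k is k'.+1 then
    exists (G' F : lmodType R) (f : {linear G -> F}) (g : {linear F -> G'}),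
      [/\ syz k' M G', flat F & short_exact f g]
  else G = M.

Lemma ex_syz k M : exists G, syz k M G.
Proof.
elim: k => [|k [G' sG]]; first by exists M.
have [G [F [f [g [fg fF _]]]]] := ex_cover G'.
by exists G, G', F, f, g.
Qed.

Lemma syz_prepend k M K F G (f : {linear K -> F}) (g : {linear F -> M}) :
  short_exact f g -> flat F -> syz k K G -> syz k.+1 M G.
Proof.
move=> fg fF; elim: k G => [|k IH] G; first by move=> ->; exists M, F, f, g.
move=> [G' [F' [f' [g' [/IH sG fF' fg']]]]].
by exists G', F', f', g'.
Qed.

Lemma syz_tail j k M G : syz (j + k) M G -> exists M', syz k M' G.
Proof.
elim: k G => [|k IH] G; first by exists G.
rewrite addnS => -[G' [F [f [g [/IH[M' sM'] fF fg]]]]].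
by exists M', G', F, f, g.
Qed.

Lemma syz_iso k M M' (h : {linear M -> M'}) G : injective h -> onto h ->
  syz k.+1 M G -> syz k.+1 M' G.
Proof.
move=> hi hs; elim: k G => [|k IH] G; last first.
  move=> [G' [F [f [g [/IH sG fF fg]]]]]; by exists G', F, f, g.
move=> [G' [F [f [g [eG fF fg]]]]]; subst G'; exists M', F, f, (h \o g); split=> //.
exact: short_exact_iso.
Qed.

(** Tor_1(B, G) is Tor_(k+1)(B, M) for any k-th syzygy G of M, so its vanishing
   is the same for all of them. The proof moves the syzygies one by one to B. *)
Lemma Tor1_syz_indep k M G1 G2 (B : lmodType R^c) :
  syz k M G1 -> syz k M G2 -> Tor1_zero B G1 -> Tor1_zero B G2.
Proof.
elim: k G1 G2 B => [|k IH] G1 G2 B; first by move=> -> ->.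
move=> [G1' [F1 [f1 [g1 [s1 fF1 fg1]]]]] [G2' [F2 [f2 [g2 [s2 fF2 fg2]]]]].
have [A [P [a [p [ap fP _]]]]] := ex_cover B.
move/(Tor1_shift ap fP fg1 fF1)/(IH _ _ _ s1 s2).
by move/(Tor1_shift ap fP fg2 fF2).
Qed.

(** The vanishing of Tor_(k+1)(B, M); the index is shifted by one. *)
Definition TorS_zero k (B : lmodType R^c) M := forall G, syz k M G -> Tor1_zero B G.

Lemma flat_zero Z : (forall z : Z, z = 0) -> flat Z.
Proof.
move=> Z0; apply/flatP => A B f fi; apply: injectiveP0 => x _.
by apply: (@tens_ext _ _ _ _ idfun \0) => a z; rewrite /= (Z0 z) tensor0r.
Qed.

(** P * Q splits into P and Q, and so does its tensor product with A. *)
Lemma flat_prod P Q : flat P -> flat Q -> flat (P * Q)%type.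
Proof.
move=> /flatP fP /flatP fQ; apply/flatP => A B f fi; apply: injectiveP0 => x fx.
have L1 : linear (fun z : P * Q => z.1) by [].
have L2 : linear (fun z : P * Q => z.2) by [].
have I1 : linear (fun z : P => (z, 0) : P * Q).
  by move=> a z t; congr (_, _); rewrite /= scaler0 addr0.
have I2 : linear (fun z : Q => (0, z) : P * Q).
  by move=> a z t; congr (_, _); rewrite /= scaler0 addr0.
have z1 : (A ⊗> mklin L1) x = 0.
  apply: (inj0P (fP _ _ f fi)); apply: etrans (esym (tens_map_swap _ _ _)) _.
  by rewrite [tens_map f _ _]fx raddf0.
have z2 : (A ⊗> mklin L2) x = 0.
  apply: (inj0P (fQ _ _ f fi)); apply: etrans (esym (tens_map_swap _ _ _)) _.
  by rewrite [tens_map f _ _]fx raddf0.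
pose u : {additive tens A (P * Q)%type -> tens A (P * Q)%type} :=
  ((A ⊗> mklin I1) \o (A ⊗> mklin L1)) \+ ((A ⊗> mklin I2) \o (A ⊗> mklin L2)).
have uE : idfun =1 u.
  apply: tens_ext => a [z t].
  rewrite /u /= !tens_mapE /= -tensorDr; congr (tensor _ _).
  by congr (_, _); rewrite /= ?addr0 ?add0r.
by rewrite [x]uE /u /= z1 z2 !raddf0 addr0.
Qed.

(** P' is P * Q, where Q is a free cover of L; as Q is projective its map to L
   lifts to E, which makes P * Q a cover of E. *)
Lemma horseshoe1 M E L (i : {linear M -> E}) (p : {linear E -> L})
    K P (f : {linear K -> P}) (g : {linear P -> M}) :
  short_exact i p -> short_exact f g -> flat P ->
  exists (K' P' K'' Q : lmodType R)
    (f' : {linear K' -> P'}) (g' : {linear P' -> E})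
    (f'' : {linear K'' -> Q}) (g'' : {linear Q -> L})
    (u : {linear K -> K'}) (v : {linear K' -> K''}),
    [/\ short_exact f' g', flat P', short_exact f'' g'', flat Q & short_exact u v].
Proof.
move=> [ii ip ps] [fi fg gs] fP.
have [K'' [Q [f'' [q [[fi'' fq qs] fQ pQ]]]]] := ex_cover L.
have [q' q'E] := pQ _ _ p q ps.
have wL : linear (fun z : P * Q => i (g z.1) + q' z.2).
  move=> a z t; rewrite !linearP scalerDr -!addrA; congr (_ + _).
  by rewrite addrCA.
have [K' [f' [fi' fw]]] := ex_ker (mklin wL).
have K'E z : i (g (f' z).1) + q' (f' z).2 = 0.
  by have := (fw (f' z)).2 (ex_intro _ z erefl).
have I1 : linear (fun z : K => (f z, 0) : P * Q).
  by move=> a z t; congr (_, _); rewrite /= ?linearP // scaler0 addr0.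
have [|u uE] := @mono_factor _ _ _ _ f' (mklin I1) fi'.
  move=> k; apply/fw; rewrite /= linear0 addr0.
  by rewrite (fg (f k)).2 ?linear0 //; exists k.
have L2 : linear (fun z : K' => (f' z).2) by move=> a z t; rewrite linearP.
have [|v vE] := @mono_factor _ _ _ _ f'' (mklin L2) fi''.
  move=> k; apply/fq; rewrite /= -q'E.
  have := congr1 p (K'E k); rewrite linearD linear0 (ip (i _)).2 ?add0r //.
  by exists (g (f' k).1).
exists K', (P * Q)%type, K'', Q, f', (mklin wL), f'', q, u, v; split=> //.
- split=> // e; have [y yE] := qs (p e).
  have /ip[m mE] : p (e - q' y) = 0 by rewrite linearB q'E yE subrr.
  have [x xE] := gs m; exists (x, y); by rewrite /= xE mE subrK.
- exact: flat_prod.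
- split=> [x y xy|z|y].
  + apply: fi; have := congr1 f' xy; by rewrite !uE => -[].
  + split=> [vz|[k <-]]; last first.
      by apply: (inj0P fi''); rewrite [LHS]vE /= uE.
    have z2 : (f' z).2 = 0 by have := vE z; rewrite vz linear0.
    have := K'E z; rewrite z2 linear0 addr0 => /(inj0P ii)/fg[k kE].
    by exists k; apply: fi'; rewrite uE /= kE -z2; case: (f' z).
  + have /ip[m mE] : p (q' (f'' y)) = 0.
      by rewrite q'E; apply/fq; exists y.
    have [x xE] := gs m.
    have /fw[z zE] : mklin wL (- x, f'' y) = 0.
      by rewrite /= !linearN /= xE mE addNr.
    by exists z; apply: fi''; rewrite vE /= zE.
Qed.

(** The sequence of k-th syzygies of M, E and L starts with a prescribed syzygy
   of M; those of E and L are chosen along the way. *)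
Lemma horseshoe k M E L (i : {linear M -> E}) (p : {linear E -> L}) G :
  short_exact i p -> syz k M G -> exists (G' G'' : lmodType R)
    (u : {linear G -> G'}) (v : {linear G' -> G''}),
    [/\ short_exact u v, syz k E G' & syz k L G''].
Proof.
move=> ip; elim: k G => [|k IH] G /=; first by move=> ->; exists E, L, i, p.
move=> [K [F [f [g [sK fF fg]]]]].
have [K' [K'' [u [v [uv sK' sK'']]]]] := IH K sK.
have [G' [P' [G'' [Q [f' [g' [f'' [g'' [u' [v' [h1 h2 h3 h4 h5]]]]]]]]]]] :=
  horseshoe1 uv fg fF.
exists G', G'', u', v'; split=> //; first by exists K', P', f', g'.
by exists K'', Q, f'', g''.
Qed.

(** This is the exactness of Tor_(k+2)(B, X) -> Tor_(k+2)(B, M) ->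
   Tor_(k+1)(B, K), reduced to k = 0 by passing to k-th syzygies. *)
Lemma TorS_zero_coker k B K X M (f : {linear K -> X}) (g : {linear X -> M}) :
  short_exact f g -> TorS_zero k B K -> TorS_zero k.+1 B X -> TorS_zero k.+1 B M.
Proof.
move=> fg tK tX; have [K' sK] := ex_syz k K.
have [X' [M' [u [v [uv sX sM]]]]] := horseshoe fg sK.
have [A [P [a [p [ap fP _]]]]] := ex_cover B.
have tAM : Tor1_zero A M'.
  apply: (Tor1_zero_of_injr uv); last by apply: (Tor1_zero_syz_inj ap fP uv); apply: tK.
  have [X'' [F [f' [g' [fg' fF _]]]]] := ex_cover X'.
  by apply/(Tor1_shift ap fP fg' fF)/tX; exists X', F, f', g'.
have [M'' [F [f' [g' [fg' fF _]]]]] := ex_cover M'.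
have s'' : syz k.+1 M M'' by exists M', F, f', g'.
move=> G sG; apply: (Tor1_syz_indep s'' sG).
exact/(Tor1_shift ap fP fg' fF).
Qed.

Lemma TorS_zero_res k B (C : lmodType R -> Prop) M :
  (forall X, C X -> forall j, TorS_zero j B X) ->
  bounded_resolution C k M -> forall j, (k <= j)%N -> TorS_zero j B M.
Proof.
move=> CT; elim: k M => [|k IH] M /=; first by move=> CM j _; apply: CT.
move=> [K [X [f [g [CX fg /IH rK]]]]] [//|j] kj.
by apply: (TorS_zero_coker fg); [apply: rK|apply: CT].
Qed.

(** A flat dimension at most k can be read off from any k-th syzygy, because
   flatness is vanishing of Tor_1, which does not depend on the syzygy. *)
Lemma flat_syz_of_resolution k E G :
  bounded_resolution (@flat R) k E -> syz k E G -> flat G.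
Proof.
move=> rE sG; suff [G0 sG0 fG0] : exists2 G0, syz k E G0 & flat G0.
  by apply/flat_Tor1 => B; apply: (Tor1_syz_indep sG0 sG); move/flat_Tor1: fG0; apply.
elim: k E rE {G sG} => [|k IH] E /=; first by exists E.
move=> [K [F [f [g [fF fg /IH[G sG fG]]]]]].
by exists G => //; apply: (syz_prepend fg).
Qed.

Lemma bounded_resolution_of_syz (C : lmodType R -> Prop) k M :
  (forall F, flat F -> C F) -> (forall G, syz k M G -> C G) ->
  bounded_resolution C k M.
Proof.
move=> CF; elim: k M => [|k IH] M h /=; first exact: h.
have [K [F [f [g [fg fF _]]]]] := ex_cover M.
exists K, F, f, g; split=> //; first exact: CF.
by apply: IH => G sG; apply/h/(syz_prepend fg).
Qed.

End Resolutions.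

(** fd B <= k if and only if Tor_(k+1)(B, -) vanishes. Each step of a flat
   resolution of B is exchanged for a step of a flat resolution of M. *)
Lemma flat_resolution_right (R : pzRingType) k (B : lmodType R^c) :
  bounded_resolution (@flat R^c) k B <-> forall M : lmodType R, TorS_zero k B M.
Proof.
elim: k B => [|k IH] B /=.
  by rewrite flat_right_Tor1; split=> [h M G ->|h M]; [apply: h|apply: (h M)].
split=> [[A [P [a [p [fP ap /IH rA]]]]] M G [G' [F [f [g [sG' fF fg]]]]]|h].
  by apply/(Tor1_shift ap fP fg fF)/(rA M).
have [A [P [a [p [ap fP _]]]]] := ex_cover B; exists A, P, a, p; split=> //.
apply/IH => M G' sG'; have [G [F [f [g [fg fF _]]]]] := ex_cover G'.
by apply/(Tor1_shift ap fP fg fF)/(h M); exists G', F, f, g.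
Qed.

(** A finite flat dimension of E drops to d as soon as right modules N embed in
   modules I with Tor_(d+1)(I, -) = 0. If the (t+1)-st syzygy K of E is flat,
   t >= d and G is a t-th syzygy with cover F, then N ⊗ K -> I ⊗ K -> I ⊗ F is
   injective, so N ⊗ K -> N ⊗ F is, that is Tor_1(N, G) = 0. *)
Lemma flat_syz_descend (R : pzRingType) d t (E : lmodType R) :
  (forall N : lmodType R^c, exists (I : lmodType R^c) (a : {linear N -> I}),
     injective a /\ forall M : lmodType R, TorS_zero d I M) ->
  bounded_resolution (@flat R) (t + d) E -> forall G, syz d E G -> flat G.
Proof.
move=> emb rE; have : forall G, syz (t + d) E G -> flat G.
  by move=> G; apply: flat_syz_of_resolution.
elim: t {rE} => // t IH h; apply: IH => G sG; apply/flat_Tor1 => N.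
have [I [a [ai tI]]] := emb N.
have [K [F [f [g [fg fF _]]]]] := ex_cover G.
have fK : flat K by apply: h; exists G, F, f, g.
have tIG : Tor1_zero I G by have [M' sM'] := syz_tail sG; apply: (tI M').
apply: (Tor1_zero_of_injr fg); first by move/flat_Tor1: fF; apply.
move=> x y xy; move/flatP: fK => /(_ _ _ a ai)-aK; apply: aK.
by apply: (tIG _ _ _ _ fg); rewrite !tens_map_swap xy.
Qed.

(** * Divisible groups and enough injectives *)

Definition divisible (D : zmodType) :=
  forall (n : nat) (d : D), exists e : D, e *+ n.+1 = d.

Lemma pair_mulrz (B D : zmodType) (x : B * D) (n : int) :
  x *~ n = (x.1 *~ n, x.2 *~ n).
Proof.
pose p1 : {additive B * D -> B} := mkadd (fun x y : B * D => erefl (x.1 - y.1)).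
pose p2 : {additive B * D -> D} := mkadd (fun x y : B * D => erefl (x.2 - y.2)).
by rewrite [LHS]surjective_pairing -[_.1]/(p1 _) -[_.2]/(p2 _) !raddfMz.
Qed.

Section DivisibleExtension.
Variables (A B D : zmodType) (i : {additive A -> B}) (f : {additive A -> D}).
Hypotheses (ii : injective i) (Ddiv : divisible D).
Local Open Scope classical_set_scope.

(** Graphs of homomorphisms to D, defined on subgroups of B containing the image
   of A, that extend f along i. *)
Definition partial_hom (G : set (B * D)) :=
  [/\ forall a, G (i a, f a), forall x y, G x -> G y -> G (x - y) &
      forall d, G (0, d) -> d = 0].

Lemma partial_hom0 G : partial_hom G -> G 0.
Proof. by move=> [ia _ _]; have := ia 0; rewrite !raddf0. Qed.

Lemma partial_homZ G x (n : int) : partial_hom G -> G x -> G (x *~ n).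
Proof.
move=> hG Gx; have [_ GB _] := hG; have G0 := partial_hom0 hG.
have GN y : G y -> G (- y) by move=> Gy; rewrite -sub0r; apply: GB.
have Gn k : G (x *+ k).
  elim: k => [|k IH]; first by rewrite mulr0n.
  by rewrite mulrSr -[x in _ + x]opprK; apply/GB/GN.
by case: n => n; [apply: Gn|apply/GN/Gn].
Qed.

(** A value e for b that is compatible with the partial homomorphism G: the
   multiples of b in the domain are those of a least positive one, m b, and e is
   obtained by dividing the value at m b by m. If there is none, any e works. *)
Lemma partial_hom_value G b : partial_hom G ->
  exists e, forall (n : int) d, G (b *~ n, d) -> d = e *~ n.
Proof.
move=> hG; have [_ GB Gf] := hG.
have [exm|nex] := pselect (exists m, `[< exists d, G (b *+ m.+1, d) >]).
  case: (ex_minnP exm) => m /asboolP[d0 Gd0] mmin.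
  have [e eE] := Ddiv m d0; exists e => n d Gd.
  have := divz_eq n m.+1; set q := (n %/ _)%Z.
  have := modz_ge0 n (isT : m.+1%:Z != 0).
  have := ltz_pmod n (isT : 0 < m.+1%:Z).
  case: (n %% _)%Z => // r rm _ nE.
  have := GB _ _ Gd (partial_homZ q hG Gd0).
  have -> : (b *~ n, d) - (b *+ m.+1, d0) *~ q = (b *+ r, d - d0 *~ q).
    rewrite pair_mulrz; congr (_, _); apply/eqP.
    rewrite /= subr_eq nE mulrzDr addrC.
    by rewrite mulrC mulrzA.
  case: r rm nE => [|r] rm nE Gr; last first.
    have /mmin : `[< exists d, G (b *+ r.+1, d) >].
      by apply/asboolP; eexists; apply: Gr.
    by move: rm; rewrite ltz_nat ltnS => /leq_trans h /h; rewrite ltnn.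
  rewrite mulr0n in Gr; have /eqP := Gf _ Gr; rewrite subr_eq0 => /eqP ->.
  by rewrite -eE nE addr0 pmulrn -mulrzA mulrC.
(* Only the zero multiple of b is in the domain. *)
exists 0 => n d Gd; rewrite mul0rz.
case: n Gd => [[|n]|n] Gd; first exact: Gf.
  by case: nex; exists n; apply/asboolP; exists d.
case: nex; exists n; apply/asboolP; exists (- d).
have := partial_homZ (-1) hG Gd.
by rewrite mulrN1z NegzE mulrNz -[X in G X -> _]/(_, _) opprK.
Qed.

(** Divisible groups are injective. Zorn's lemma gives a maximal partial
   homomorphism, which is total since its domain can be enlarged by any b. *)
Lemma divisible_extension : exists h : {additive B -> D}, forall a, h (i a) = f a.
Proof.
(* The empty graph is admitted because the empty chain must have an upper
   bound; a maximal graph is not empty, as the graph of f along i shows. *)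
pose P (G : set (B * D)) := G = set0 \/ partial_hom G.
have chain (F : set (set (B * D))) :
    F `<=` P -> total_on F subset -> P (\bigcup_(X in F) X).
  move=> FP Ft.
  have [[X FX hX]|nh] := pselect (exists2 X, F X & partial_hom X); last first.
    left; rewrite -subset0 => x [X FX Xx].
    have [X0|hX] := FP _ FX; first by rewrite X0 in Xx.
    by case: nh; exists X.
  right; split.
  - by move=> a; exists X => //; case: hX.
  - have key Y Z : F Y -> F Z -> Y `<=` Z ->
        forall x y, Y x -> Z y -> Z (x - y) /\ Z (y - x).
      move=> FY FZ YZ x y /YZ Zx Zy.
      have [Z0|[_ ZB _]] := FP _ FZ; first by rewrite Z0 in Zx.
      by split; apply: ZB.
    move=> x y [Y FY Yx] [Z FZ Zy]; have [YZ|ZY] := Ft _ _ FY FZ.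
      by exists Z => //; case: (key _ _ FY FZ YZ _ _ Yx Zy).
    by exists Y => //; case: (key _ _ FZ FY ZY _ _ Zy Yx).
  - move=> d [Y FY Yd].
    have [Y0|[_ _ Yf]] := FP _ FY; first by rewrite Y0 in Yd.
    exact: Yf.
have [G [PG Gmax]] := Zorn_bigcup chain.
have hG : partial_hom G.
  case: PG => // G0; exfalso.
  pose G1 : set (B * D) := [set x | exists a, x = (i a, f a)].
  have h1 : partial_hom G1.
    split=> [a|_ _ [x ->] [y ->]|d [a [ia ->]]]; first by exists a.
      by exists (x - y); rewrite !raddfB.
    by rewrite (inj0P ii (esym ia)) raddf0.
  apply: (Gmax G1); last by right.
  rewrite properEneq; split; last by rewrite G0; exact: sub0set.
  by apply/eqP => GG1; have := partial_hom0 h1; rewrite -GG1 G0.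
have [_ GB Gf] := hG.
have tot b : exists d, G (b, d).
  have [e eE] := partial_hom_value b hG.
  pose G' : set (B * D) :=
    [set z | exists n x, G x /\ z = (x.1 + b *~ n, x.2 + e *~ n)].
  have hG' : partial_hom G'.
    split.
    - move=> a; exists 0, (i a, f a); rewrite /= !addr0.
      by split=> //; case: hG.
    - move=> _ _ [m [x [Gx ->]]] [n [y [Gy ->]]].
      exists (m - n), (x - y); split; first exact: GB.
      by congr (_, _); rewrite /= mulrzBr opprD addrACA.
    - move=> d [n [x [Gx [x1 ->]]]].
      have E : x.1 = b *~ (- n).
        by apply/eqP; rewrite mulrNz -addr_eq0 -x1.
      have := eE (- n) x.2; rewrite -E => ->; first by rewrite mulrNz addNr.
      by case: x Gx {x1 E}.
  have G'b : G' (b, e).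
    by exists 1, 0; split; [apply: partial_hom0|rewrite /= !add0r].
  have [|GG'] := pselect (G (b, e)); first by exists e.
  exfalso; apply: (Gmax G'); last by right.
  rewrite properEneq; split; last first.
    by move=> x Gx; exists 0, x; rewrite !addr0; split=> //; case: x {Gx}.
  by apply/eqP => E; apply: GG'; rewrite E.
have [h hE] := choice tot.
have hB : zmod_morphism h.
  move=> x y; apply/eqP; rewrite -subr_eq0; apply/eqP/Gf.
  have := GB _ _ (hE (x - y)) (GB _ _ (hE x) (hE y)).
  by rewrite -[X in G X]/(_ , _) /= subrr.
exists (mkadd hB) => a /=; apply/eqP; rewrite -subr_eq0; apply/eqP/Gf.
have [ia _ _] := hG.
by have := GB _ _ (hE (i a)) (ia a); rewrite -[X in G X]/(_, _) /= subrr.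
Qed.

End DivisibleExtension.

(** D is the pushout of the map from the free abelian group on M to its
   rationalization and of the canonical map eps to M. An element (y, m) of the
   sum is congruent to one with second component zero, hence divisible, and M
   embeds because the rationalization map iota is injective. *)
Lemma ex_divisible (M : zmodType) :
  exists (D : zmodType) (j : {additive M -> D}), injective j /\ divisible D.
Proof.
have kD (k : M) : zmod_morphism (fun n : int => k *~ n).
  by move=> m n; rewrite mulrzBr.
have lD (k : M) : zmod_morphism (fun n : int => mkmalgU k (n%:~R : rat)).
  by move=> m n; rewrite rmorphB /= monalgUB.
pose eps : {additive {malg int[M]} -> M} := malg_lift (fun k => mkadd (kD k)).
pose iota : {additive {malg int[M]} -> {malg rat[M]}} :=
  malg_lift (fun k => mkadd (lD k)).
have iotaE x k : mcoeff k (iota x) = (mcoeff k x)%:~R.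
  rewrite /iota /= /malg_lift (raddf_sum (mcoeff k)) [in RHS](monalgE x).
  rewrite (raddf_sum (mcoeff k)) (raddf_sum (intr : int -> rat)) /=.
  by apply: eq_bigr => l _; rewrite !mcoeffU; case: eqP.
have cD : zmod_morphism (fun x => (iota x, eps x)).
  by move=> x y; congr (_, _); rewrite raddfB.
have [D [q [qe qs]]] := ex_add_coker (mkadd cD).
have jD : zmod_morphism (fun m => q (0, m)).
  by move=> x y; rewrite -raddfB; congr (q (_, _)); rewrite /= subr0.
exists D, (mkadd jD); split.
  apply: injectiveP0 => m /qe[x [x0 <-]].
  suff -> : x = 0 by rewrite raddf0.
  apply/malgP => k; have := iotaE x k; rewrite [iota x]x0 !mcoeff0 => /esym/eqP.
  by rewrite intr_eq0 => /eqP.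
move=> n d; have [[y m] <-] := qs d.
have /eqP : q ((y, m) - (iota (mkmalgU m 1), eps (mkmalgU m 1))) = q (y, m).
  rewrite raddfB -[RHS]subr0; congr (_ - _); apply/qe.
  by exists (mkmalgU m 1).
rewrite -[_ - _]/(_, _) /= [X in m - X]malg_liftU /= subrr => /eqP <-.
set z := (y - _).
have [t tE] : exists t : {malg rat[M]}, t *+ n.+1 = z.
  have gD (k : M) : zmod_morphism (fun a : rat => mkmalgU k (a / n.+1%:R)).
    by move=> a b; rewrite mulrBl monalgUB.
  exists (malg_lift (fun k => mkadd (gD k)) z).
  rewrite /malg_lift -sumrMnl [RHS]monalgE; apply: eq_bigr => k _ /=.
  rewrite -monalgUMn; congr (mkmalgU _ _).
  by rewrite -[LHS]mulr_natr mulfVK // Num.Theory.pnatr_eq0.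
exists (q (t, 0)); rewrite -raddfMn -tE; congr (q _).
by rewrite [LHS]pmulrn pair_mulrz /= mul0rz.
Qed.

Definition inj_module (R : pzRingType) (E : lmodType R) :=
  forall (A B : lmodType R) (i : {linear A -> B}) (f : {linear A -> E}),
    injective i -> exists h : {linear B -> E}, forall a, h (i a) = f a.

(** The group of additive maps from R to D, with r acting by right translation
   of the argument. Linear maps from B to it are additive maps from B to D, so
   it is injective when D is divisible. *)
Section Coinduced.
Variables (R : pzRingType) (D : zmodType).
Definition additive_pred : {pred R -> D} := fun f => `[< zmod_morphism f >].
Lemma additive_pred_closed : zmod_closed additive_pred.
Proof.
split; first by apply/asboolP => x y; rewrite /= subr0.
move=> f g /asboolP fA /asboolP gA; apply/asboolP => x y.
by rewrite !fctE fA gA !opprD !opprK addrACA.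
Qed.
HB.instance Definition _ :=
  GRing.isZmodClosed.Build (R -> D) additive_pred additive_pred_closed.
Record coind :=
  Coind { coind_fun :> R -> D; coind_mem : coind_fun \in additive_pred }.
HB.instance Definition _ := [isSub for coind_fun].
HB.instance Definition _ := [Choice of coind by <:].
HB.instance Definition _ := [SubChoice_isSubZmodule of coind by <:].
Lemma coindB (p : coind) : zmod_morphism p.
Proof. by case: p => f /= /asboolP. Qed.
Lemma coindP (p q : coind) : (forall x, p x = q x) -> p = q.
Proof. by move=> pq; apply/val_inj/funext. Qed.
Lemma coindD (p q : coind) x : (p + q) x = p x + q x.
Proof. by []. Qed.
Lemma coind_scaleP (r : R) (p : coind) : (fun x => p (x * r)) \in additive_pred.
Proof. by apply/asboolP => x y; rewrite mulrBl coindB. Qed.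
Definition coind_scale r p : coind := Coind (coind_scaleP r p).
Lemma coind_scaleA a b p : coind_scale a (coind_scale b p) = coind_scale (a * b) p.
Proof. by apply: coindP => x /=; rewrite mulrA. Qed.
Lemma coind_scale1 p : coind_scale 1 p = p.
Proof. by apply: coindP => x /=; rewrite mulr1. Qed.
Lemma coind_scaleDr : right_distributive coind_scale +%R.
Proof. by move=> a p q; apply: coindP. Qed.
Lemma coind_scaleDl p : {morph coind_scale^~ p : a b / a + b}.
Proof.
move=> a b; apply: coindP => x; rewrite coindD /= mulrDr.
exact: (raddfD (mkadd (coindB p))).
Qed.
HB.instance Definition _ := GRing.Zmodule_isLmodule.Build R coind
  coind_scaleA coind_scale1 coind_scaleDr coind_scaleDl.

Lemma coind_linear (B : lmodType R) (h : {additive B -> D}) :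
  exists k : {linear B -> coind}, forall b r, k b r = h (r *: b).
Proof.
have hP b : (fun r : R => h (r *: b)) \in additive_pred.
  by apply/asboolP => x y; rewrite scalerBl raddfB.
have L : linear (fun b => Coind (hP b)).
  move=> a x y; apply: coindP => r; rewrite coindD /=.
  by rewrite scalerDr raddfD scalerA.
by exists (mklin L).
Qed.

Lemma coind_inj : divisible D -> inj_module coind.
Proof.
move=> Dd A B i f ii.
have eA : zmod_morphism (fun a => f a 1) by move=> x y; rewrite linearB.
have [h hE] := divisible_extension (mkadd eA) ii Dd.
have [k kE] := coind_linear h; exists k => a; apply: coindP => r.
by rewrite kE -linearZ hE /= linearZ /= mul1r.
Qed.
End Coinduced.

(** M embeds in the coinduced module of a divisible group that contains M, the
   element m going to the map r |-> r m. *)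
Lemma ex_injective (R : pzRingType) (M : lmodType R) :
  exists (E : lmodType R) (i : {linear M -> E}), injective i /\ inj_module E.
Proof.
have [D [j [ji Dd]]] := ex_divisible M; have [k kE] := coind_linear j.
exists (coind R D), k; split; last exact: coind_inj.
move=> x y xy; apply: ji; have := congr1 (fun p : coind R D => p 1) xy.
by rewrite !kE !scale1r.
Qed.

(** A map P_1 -> E that vanishes on the image of P_2 factors through the image of
   P_1 in P_0, from which it extends to P_0. *)
Lemma inj_FP_inj (R : pzRingType) n (E : lmodType R) : inj_module E -> FP_inj n E.
Proof.
move=> Ei M _ P /is_resolutionP[_ P0 P1] _ f f0.
have [I [s [i [ss ii siE]]]] := ex_image (diff P 0).
have [|h hE] := @epi_factor _ _ _ _ s f ss.
  move=> x sx; have /P1[y <-] : diff P 0 x = 0 by rewrite -siE sx linear0.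
  exact: f0.
have [g gE] := Ei _ _ i h ii.
by exists g => x; rewrite -siE gE hE.
Qed.

(** * Gorenstein flat modules and k-th syzygies *)

Section GF.
Variables (R : pzRingType) (BB : lmodType R^c -> Prop).
Implicit Types (G X Y : lmodType R).

Lemma GF_iso : iso_closed (GF BB).
Proof.
move=> M M' h hi hs [F [d [fF de dB [j [ji je]]]]].
have [h' [hK h'K [h'i h's]]] := iso_inv hi hs.
exists F, d; split=> //; exists (j \o h'); split.
  by move=> x y /ji/h'i.
move=> x; apply: iff_trans (je x) _; split=> [[m <-]|[m <-]].
  by exists (h m); rewrite /= hK.
by exists (h' m).
Qed.

(** The cycles Z i of the complex are syzygies of each other, so it is enough to
   see that Tor_1(B, Z i) = 0. The complex B ⊗ F is exact and F (i - 2) maps onto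
   Z (i - 1), which makes B ⊗ Z (i - 1) -> B ⊗ F (i - 1) injective. *)
Lemma GF_TorS_zero G B k : GF BB G -> BB B -> TorS_zero k B G.
Proof.
move=> [F [d [fF de dB [j [ji je]]]]] BBB.
pose Z i := kernel (d i); pose f i : {linear Z i -> F i} := kernel_incl (d i).
have fi i : injective (f i) by exact: kernel_incl_inj.
have fe i : exact_at (f i) (d i) by exact: kernel_incl_exact.
have /all_sig[e eE] i :
    {e : {linear F i -> Z (i + 1)} | forall x, f (i + 1) (e x) = d i x}.
  apply/cid/mono_factor => // x; apply/fe/de.
  by exists x.
have es i : onto (e i).
  move=> z; have /de[x xE] : d (i + 1) (f (i + 1) z) = 0 by apply/fe; exists z.
  by exists x; apply: fi; rewrite eE.
have fe_exact i : short_exact (f i) (e i).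
  split=> // x; apply: iff_trans (fe i x); rewrite -eE.
  by split=> [->|/(inj0P (@fi _))//]; rewrite linear0.
have Bf i : injective (B ⊗> f (i + 1 + 1)).
  apply: injectiveP0 => x fx.
  have [_ fei _] := fe_exact (i + 1).
  have [ex s] := tens_right_exact_right B fei (es (i + 1)).
  have [y yx] := s x.
  have /dB : (B ⊗> d (i + 1)) y = 0.
    by rewrite -(tens_map_compr (eE (i + 1))) yx.
  move=> /(_ BBB)[z zy].
  rewrite -yx -zy (@tens_map_compr _ _ _ _ _ (d i) (e (i + 1)) \0).
    by rewrite tens_map_0r.
  move=> t; apply: (@fi (i + 1 + 1)); rewrite eE linear0; apply/de; by exists t.
have TZ i : Tor1_zero B (Z i).
  have -> : i = i - 1 - 1 - 1 + 1 + 1 + 1 by rewrite !subrK.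
  apply: (Tor1_zero_of_injr (fe_exact _)); last exact: Bf.
  exact: ((flat_Tor1 (F _)).1 (fF _)).
have sZ m i : exists l, syz m (Z i) (Z l).
  elim: m => [|m [l sl]]; first by exists i.
  exists (l - 1), (Z (l - 1 + 1)), (F (l - 1)), (f (l - 1)), (e (l - 1)).
  by split; [rewrite subrK|exact: fF|exact: fe_exact].
have [|h hE] := @mono_factor _ _ _ _ (f 0) j (@fi 0).
  by move=> x; apply/fe/je; exists x.
have hi : injective h by move=> x y xy; apply: ji; rewrite -!hE xy.
have hs : onto h.
  move=> z; have /je[x xE] : d 0 (f 0 z) = 0 by apply/fe; exists z.
  by exists x; apply: (@fi 0); rewrite hE.
have [h' [_ _ [h'i h's]]] := iso_inv hi hs.
have [l sl] := sZ k 0.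
case: k sl => [|k] sl X; first by move=> ->; apply: Tor1_zero_iso h'i h's (TZ 0).
move=> /(syz_iso hi hs) sX; exact: Tor1_syz_indep sl sX (TZ l).
Qed.

Definition flat_step X Y :=
  exists (F : lmodType R) (f : {linear X -> F}) (g : {linear F -> Y}),
    flat F /\ short_exact f g.

(** From a module of CC one continues to the right and to the left within CC;
   splicing the short exact sequences gives the complex. The modules Z i of CC
   are its cycles, and Tor_1(B, Z i) = 0 keeps each short exact sequence exact
   under B ⊗ -. Building the sequence Z of modules first, with the mere existence
   of the steps from Z i to Z (i + 1), avoids transporting maps along equations
   between integers. *)
Lemma GF_of_class (CC : lmodType R -> Prop) :
  (forall X B, CC X -> BB B -> Tor1_zero B X) ->
  (forall X, CC X -> exists2 Y, CC Y & flat_step X Y) ->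
  (forall Y, CC Y -> exists2 X, CC X & flat_step X Y) ->
  forall G, CC G -> GF BB G.
Proof.
move=> CT Cr Cl G CG; pose T := {X : lmodType R | CC X}.
have /choice[nxt nxtP] (X : T) : exists Y : T, flat_step (sval X) (sval Y).
  by case: X => X CX; have [Y CY XY] := Cr X CX; exists (exist _ Y CY).
have /choice[prv prvP] (Y : T) : exists X : T, flat_step (sval X) (sval Y).
  by case: Y => Y CY; have [X CX XY] := Cl Y CY; exists (exist _ X CX).
pose Z (i : int) : T := match i with
  | Posz m => iter m nxt (exist _ G CG)
  | Negz m => iter m.+1 prv (exist _ G CG) end.
have Zstep i : flat_step (sval (Z i)) (sval (Z (i + 1))).
  case: i => [m|[|m]].
  - by have -> : Posz m + 1 = m.+1 by rewrite addrC.
  - exact: prvP.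
  - have -> : Negz m.+1 + 1 = Negz m by rewrite !NegzE -addn1 PoszD opprD addrNK.
    exact: prvP.
have /choice[F FP] := Zstep.
have /all_sig[f fP] i : {f : {linear sval (Z i) -> F i} |
    exists g : {linear F i -> sval (Z (i + 1))}, flat (F i) /\ short_exact f g}.
  exact: cid.
have /all_sig[g gP] i : {g : {linear F i -> sval (Z (i + 1))} |
  flat (F i) /\ short_exact (f i) g} by apply: cid.
have fF i : flat (F i) by case: (gP i).
have fg i : short_exact (f i) (g i) by case: (gP i).
pose d i : {linear F i -> F (i + 1)} := f (i + 1) \o g i.
exists F, d; split=> //.
- move=> i x; have [_ e1 s1] := fg i; have [i2 e2 s2] := fg (i + 1).
  have [i3 _ _] := fg (i + 1 + 1).
  split=> [/(inj0P i3)/e2[z <-]|[y <-]].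
    by have [y <-] := s1 z; exists y.
  by rewrite /= (e2 (f (i + 1) _)).2 ?linear0 //; eexists.
- move=> B BBB i x; have [_ e1 s1] := fg i; have [i2 e2 s2] := fg (i + 1).
  have i3 : injective (B ⊗> f (i + 1 + 1)).
    by apply: (CT _ _ (svalP (Z (i + 1 + 1 + 1))) BBB _ _ _ _ (fg (i + 1 + 1))).
  have [_ t1] := tens_right_exact_right B e1 s1.
  have [u2 t2] := tens_right_exact_right B e2 s2.
  have dE k y : (B ⊗> d k) y = (B ⊗> f (k + 1)) ((B ⊗> g k) y).
    by rewrite (@tens_map_compr _ _ _ _ _ (g k) (f (k + 1)) (d k)).
  rewrite dE; split=> [/(inj0P i3)/u2[z <-]|[y <-]].
    by have [y <-] := t1 z; exists y; rewrite dE.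
  by rewrite dE (u2 ((B ⊗> f (i + 1)) _)).2 ?raddf0 //; eexists.
- exists (f 0); have [i1 e1 s1] := fg 0; split=> // x.
  apply: iff_trans (e1 x); have [i2 _ _] := fg (0 + 1).
  by split=> [/(inj0P i2)//|/= ->]; rewrite linear0.
Qed.

(** A flat module X sits in the short exact sequences X -> X -> 0 and
   0 -> X -> X, whose other ends are flat as well. *)
Lemma GF_flat F : flat F -> GF BB F.
Proof.
have [Z Z0] := ex_zero_module R.
apply: GF_of_class F => [X B /flat_Tor1//|X fX|Y fY].
  exists Z; first exact: flat_zero.
  exists X, idfun, \0; split=> //; split=> // [x|z]; last by exists 0; rewrite (Z0 z).
  by split=> // _; exists x.
exists Z; first exact: flat_zero.
exists Y, \0, idfun; split=> //; split=> [x y _|y|y]; first by rewrite (Z0 x) (Z0 y).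
  by split=> [/= ->|[z <-]] //; exists 0.
by exists y.
Qed.

(** The class of all d-th syzygies satisfies the conditions of [GF_of_class]. A
   d-th syzygy of N embeds in one of an injective module containing N, and this
   one is flat; a first syzygy of a d-th syzygy is again a d-th syzygy. *)
Lemma GF_syz d M G :
  (forall B M, BB B -> TorS_zero d B M) ->
  (forall E G, inj_module E -> syz d E G -> flat G) ->
  syz d M G -> GF BB G.
Proof.
move=> hB hE sG; apply: (@GF_of_class (fun G => exists M, syz d M G)); last by exists M.
- by move=> X B [N sX] BBB; apply: (hB B N BBB).
- move=> X [N sX]; have [E [i [ii Ei]]] := ex_injective N.
  have [L [p [ip ps]]] := ex_coker i.
  have [|E' [L' [u [v [uv sE sL]]]]] := @horseshoe _ d _ _ _ i p X _ sX; first by [].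
  exists L'; first by exists L.
  by exists E', u, v; split=> //; apply: hE sE.
- move=> Y [N sY]; have [K [F [f [g [fg fF _]]]]] := ex_cover Y.
  exists K; last by exists F, f, g.
  have : syz (1 + d) N K by exists Y, F, f, g.
  exact: syz_tail.
Qed.

End GF.

(** * Equality of the two dimensions *)

Lemma enat_supP S k :
  le_enat (enat_sup S) (Some k) <-> forall x, S x -> le_enat x (Some k).
Proof.
rewrite le_enat_leastP; split=> [[j jk h] x /h|h]; last by exists k.
by case: x => //= a /leq_trans; apply.
Qed.

Lemma enat_eq (x y : enat) :
  (forall k, le_enat x (Some k) <-> le_enat y (Some k)) -> x = y.
Proof.
case: x y => [a|] [b|] //= h; last 2 first.
- by have [/(_ (leqnn a))] := h a.
- by have [_ /(_ (leqnn b))] := h b.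
by congr Some; apply/eqP; rewrite eqn_leq; apply/andP; split; apply/h.
Qed.

Theorem proposition3p12 (n : nat) (R : pzRingType)
    (hR : gorenstein_coherent n R) :
  (exists k : nat, lwGgl (@FP_inj n R^c) = Some k) /\
  lwGgl (@FP_inj n R^c) = fd_class (@FP_inj n R^c).
Proof.
case: hR => _ _ [m [hl hr]]; set BB := @FP_inj n R^c.
have fdP (S : pzRingType) (M : lmodType S) k :
    le_enat (fd M) (Some k) <-> bounded_resolution (@flat S) k M.
  by apply: resolution_dimP => [? ? ? hi hs|Z Z0]; [apply: flat_iso hi hs|apply: flat_zero].
have GfdP M k : le_enat (Gfd BB M) (Some k) <-> bounded_resolution (GF BB) k M.
  apply: resolution_dimP => [|Z Z0]; first exact: GF_iso.
  exact/GF_flat/flat_zero.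
have key k : le_enat (lwGgl BB) (Some k) <-> le_enat (fd_class BB) (Some k).
  rewrite /lwGgl /fd_class !enat_supP; split=> [h _ [B BBB ->]|h _ [M ->]].
    apply/fdP/flat_resolution_right => M.
    have /GfdP rM : le_enat (Gfd BB M) (Some k) by apply: h; exists M.
    by apply: (TorS_zero_res _ rM) => // X GX j; apply: GF_TorS_zero GX BBB.
  have hB B N : BB B -> TorS_zero k B N.
    move=> BBB; suff /fdP/flat_resolution_right : le_enat (fd B) (Some k) by apply.
    by apply: h; exists B.
  apply/GfdP/bounded_resolution_of_syz => [F|G]; first exact: GF_flat.
  apply: GF_syz => // E X Ei; apply: (@flat_syz_descend _ _ m).
    move=> N; have [I [a [ai Ii]]] := ex_injective N.
    by exists I, a; split=> // L; apply/hB/inj_FP_inj.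
  apply: (@bounded_resolution_leq _ _ m); first by move=> Z; apply: flat_zero.
    exact: leq_addr.
  exact/fdP/hl/inj_FP_inj.
have fin : le_enat (fd_class BB) (Some m).
  by apply/enat_supP => _ [B /hr + ->].
split; last exact: enat_eq.
have := (key m).2 fin; case: (lwGgl BB) => // k _; by exists k.
Qed.
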